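(* Let $\{\boldsymbol{Z}_n\}$ be an irreducible, non-singular lower Hessenberg branching process with $M_{i,i+1}>0$ for all $i\ge 0$, satisfying the dichotomy condition (D). Let $S=\{\boldsymbol{s}\in[0,1]^{\mathcal X}:\boldsymbol{s}=\boldsymbol{G}(\boldsymbol{s})\}$ and, for $i\in\mathcal X$, $S_i=\{x\in[0,1]:\exists\,\boldsymbol{s}\in S \text{ with } s_i=x\}$. If $S=\{\boldsymbol 1\}$ then $\boldsymbol q=\tilde{\boldsymbol q}=\boldsymbol 1$; otherwise $\boldsymbol q=\min S$ and $\tilde{\boldsymbol q}=\sup\,(S\setminus\{\boldsymbol 1\})$ (minimum and supremum taken componentwise). In particular, $S_i=[q_i,\tilde q_i]\cup\{1\}$ for all $i\ge 0$.
   Context: Lower Hessenberg branching process (LHBP): a multitype Galton-Watson process with type set $\mathcal X=\mathbb N_0=\{0,1,2,\dots\}$, started from a single individual of type $\varphi_0$. Each individual lives one generation; independently of all others, an individual of type $i$ has at death $r_\ell$ children of type $\ell$ ($\ell\in\mathcal X$) with probability $p_i(\boldsymbol r)$, where $\boldsymbol r\in R_i:=\{\boldsymbol r\in\mathbb N_0^{\mathcal X}: r_\ell=0\ \forall \ell>i+1\}$. $\boldsymbol Z_n=(Z_{n,\ell})_{\ell\in\mathcal X}$ counts the individuals of each type in generation $n$. Progeny generating vector: $\boldsymbol G:[0,1]^{\mathcal X}\to[0,1]^{\mathcal X}$, $G_i(\boldsymbol s)=\sum_{\boldsymbol r\in R_i}p_i(\boldsymbol r)\prod_{k=0}^{i+1}s_k^{r_k}$.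 Mean progeny matrix: $M_{i,j}=\partial G_i/\partial s_j$ at $\boldsymbol s=\boldsymbol 1$. Irreducible: in the directed graph on $\mathcal X$ with an edge $i\to j$ iff $M_{i,j}>0$ there is a path between any two vertices. Non-singular: there is $i\in\mathcal X$ with $\sum_{\boldsymbol v:|\boldsymbol v|=1}p_i(\boldsymbol v)<1$, where $|\boldsymbol v|=\sum_\ell v_\ell$. Extinction probabilities: $q_i=\mathbb P(\lim_n\sum_\ell Z_{n,\ell}=0\mid\varphi_0=i)$ (global), $\tilde q_i=\mathbb P(\lim_n Z_{n,\ell}=0\ \forall\ell\in\mathcal X\mid\varphi_0=i)$ (partial); $\boldsymbol q=(q_i)$, $\tilde{\boldsymbol q}=(\tilde q_i)$. Process with immortal types: for $k\ge 0$, $\{\boldsymbol Z^{(k)}_n\}$ is obtained from $\{\boldsymbol Z_n\}$ by replacing the descendants of every individual of type $i>k$ by an infinite line of type-$i$ descendants (one child of type $i$ in each generation). Condition (D): for all $k\ge 0$, $\mathbb P(\lim_n\sum_{i=0}^k Z^{(k)}_{n,i}=0\mid\varphi_0=k)+\mathbb P(\lim_n\sum_{i=0}^k Z^{(k)}_{n,i}=\infty\mid\varphi_0=k)=1$. *)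

(* Defs.v *)
From HB Require Import structures.
From mathcomp Require Export all_boot all_order all_algebra.
From mathcomp Require Export all_classical all_reals all_analysis.
Import Order.TTheory GRing.Theory Num.Theory.
Import numFieldNormedType.Exports.

Set Implicit Arguments.
Unset Strict Implicit.
Unset Printing Implicit Defensive.

Local Open Scope classical_set_scope.
Local Open Scope ring_scope.

(* R_i: an individual of type i has no child of type > i + 1, so an element of
   R_i is given by its coordinates 0, ..., i + 1. *)
Definition progeny (i : nat) := {ffun 'I_i.+2 -> nat}.

Definition progeny_size (i : nat) (r : progeny i) : nat := (\sum_l r l)%N.

Definition is_progeny_law (R : realType) (p : forall i, progeny i -> R) : Prop :=
  (forall i (r : progeny i), 0 <= p i r) /\
  (forall i, (\esum_(r in [set: progeny i]) (p i r)%:E = 1)%E).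

(* The series converges in R for s in [0,1]^nat, the only s at which G is used. *)
Definition G (R : realType) (p : forall i, progeny i -> R) (s : nat -> R)
    (i : nat) : R :=
  fine (\esum_(r in [set: progeny i]) (p i r * \prod_(k < i.+2) s k ^+ r k)%:E)%E.

(* G is defined on [0,1]^nat only, so its partial derivatives at the vector 1
   are left derivatives; they may be infinite. *)
Definition mean_progeny (R : realType) (p : forall i, progeny i -> R)
    (i j : nat) : \bar R :=
  let g (t : R) := G p (fun l => if l == j then t else 1) i in
  lim (((g t - g 1) / (t - 1))%:E @[t --> (1 : R)^'-]).

Definition irreducible_type_graph (R : realType)
    (p : forall i, progeny i -> R) : Prop :=
  forall i j : nat, exists w : seq nat,
    path (fun a b : nat => (0 < mean_progeny p a b)%E) i w /\ last i w = j.

Definition nonsingular (R : realType) (p : forall i, progeny i -> R) : Prop :=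
  exists i : nat,
    (\esum_(v in [set v : progeny i | progeny_size v = 1%N]) (p i v)%:E < 1)%E.

(* Individuals are labelled by their lineage, most recent first: each entry is
   the type of the individual and its rank among its siblings of that type.
   The founder of type i is [:: (i, 0)]; the label [::] denotes nobody. *)
Definition indiv := seq (nat * nat).

Definition itype (u : indiv) : nat := (head (0, 0)%N u).1.

Definition children (i : nat) (r : progeny i) : seq (nat * nat) :=
  [seq (val l, m) | l <- enum 'I_i.+2, m <- iota 0 (r l)].

Fixpoint generation (brood : indiv -> seq (nat * nat)) (i n : nat) : seq indiv :=
  if n is n'.+1 then
    flatten [seq [seq c :: u | c <- brood u] | u <- generation brood i n']
  else [:: [:: (i, 0%N)]].

Definition brood (x : forall u : indiv, progeny (itype u)) (u : indiv) :
    seq (nat * nat) := children (x u).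

Definition brood_immortal (k : nat) (x : forall u : indiv, progeny (itype u))
    (u : indiv) : seq (nat * nat) :=
  if (itype u <= k)%N then children (x u) else [:: (itype u, 0%N)].

Definition pop (b : indiv -> seq (nat * nat)) (i n l : nat) : nat :=
  count (fun u => itype u == l) (generation b i n).

Section Process.
Context (R : realType) (d : measure_display) (Omega : measurableType d).
Context (P : probability Omega R).
Context (xi : forall u : indiv, Omega -> progeny (itype u)).

(* xi u is the progeny of the (potential) individual u. The variables are
   mutually independent, xi u has law p_(type of u), and progeny i carries the
   discrete sigma-algebra. *)
Record is_progeny_family (p : forall i, progeny i -> R) : Prop := {
  progeny_family_meas : forall u (B : set (progeny (itype u))),
    measurable (xi u @^-1` B) ;
  progeny_family_law : forall u (r : progeny (itype u)),
    P [set w | xi u w = r] = (p (itype u) r)%:E ;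
  progeny_family_indep : forall (us : seq indiv)
      (B : forall u, set (progeny (itype u))), uniq us ->
    P [set w | forall u, u \in us -> B u (xi u w)] =
    (\prod_(u <- us) P (xi u @^-1` B u))%E }.

(* Z i n l w is Z_(n,l) for the process started from one individual of type i:
   the conditional probability given phi_0 = i is the P-probability of the
   event for the family tree of the founder of type i. *)
Definition Z (i n l : nat) (w : Omega) : nat :=
  pop (brood (fun u => xi u w)) i n l.

Definition Zimm (k i n l : nat) (w : Omega) : nat :=
  pop (brood_immortal k (fun u => xi u w)) i n l.

Definition global_ext (i : nat) : R :=
  fine (P [set w |
    (\sum_(0 <= l <oo) ((Z i n l w)%:R : R)%:E)%E @[n --> \oo] --> (0 : \bar R)%E]).

Definition partial_ext (i : nat) : R :=
  fine (P [set w |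
    forall l, ((Z i n l w)%:R : R) @[n --> \oo] --> (0 : R)]).

Definition dichotomy : Prop := forall k : nat,
  let total n w : \bar R := (\sum_(l < k.+1) ((Zimm k k n l w)%:R : R)%:E)%E in
  (P [set w | total n w @[n --> \oo] --> (0 : \bar R)] +
   P [set w | total n w @[n --> \oo] --> (+oo : \bar R)] = 1)%E.

End Process.

Definition fixed_points (R : realType) (p : forall i, progeny i -> R) :
    set (nat -> R) :=
  [set s | (forall i, 0 <= s i <= 1) /\ s = G p s].

Definition fixed_points_coord (R : realType) (p : forall i, progeny i -> R)
    (i : nat) : set R :=
  [set x | 0 <= x <= 1 /\ exists s, fixed_points p s /\ s i = x].

(* Main.v *)
Require Import Defs.
From mathcomp Require Import ring lra measurable_realfun.
Import Order.TTheory GRing.Theory Num.Theory.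
Import numFieldNormedType.Exports.

Set Implicit Arguments.
Unset Strict Implicit.
Unset Printing Implicit Defensive.

Local Open Scope classical_set_scope.
Local Open Scope ring_scope.

(* Minimality of q, and the fact that q and qt solve s = G s, come from the
   usual computation of the law of finitely many generations.

   A solution s <> 1 has s < 1 everywhere, by irreducibility. Let Z_n be the
   population at time n, M_n the product of the s_l over it, y the limit of
   G^n(s^2), and Y_n the product of the y_l. Then M_n and Y_n are martingales,
   Y_n >= M_n^2, and E Y_n - E M_n^2 -> 0. Non-singularity makes
   y_l > s_l^2 whenever s_l > 0, so each visit to a type <= L at time n forces
   Y_n >= (1 + k) M_n^2. Hence M_n is small at late visits, optional stopping
   gives s <= P(types <= L are visited finitely often), and so s <= qt.

   Conversely let psi m u be the minimal solution of the first m + 1 equations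
   with all coordinates beyond m set to u. Each coordinate of psi m is convex
   and lower semicontinuous in u, so it takes every value between
   psi m 0 <= q and psi m 1 >= qt; a limit as m -> oo of such partial solutions
   through a given x at coordinate i is a solution s with s_i = x. *)

(** No conditional expectation is formed. Every mean that occurs is that of a product over
    generations, with a weight [f m] on each generation [m < n] and a weight [h] on generation [n].
    Stopping at a visit to a type [<= L] is multiplication by the indicator of the types [> L], so
    the martingale arguments become inequalities between nested expressions [f 0 * G (f 1 * G ...)].

    The choice of [y] is what makes [E Y_n - E M_n^2] vanish: this difference is [y_i - G^n(s^2)_i].

    A monomial is not jointly convex, but it is convex along a segment from [x] to [y] when
    [x <= y]. This is enough for the truncated solutions because they increase with [u].

    If [qt = 1], then [qt] is not among the solutions other than 1, and the formula for the supremum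
    comes from the solutions that interpolate between [q] and [qt]. *)

Definition discrete_rv d (Omega : measurableType d) (T : Type) (X : Omega -> T) :=
  forall B : set T, measurable (X @^-1` B).

(** * Discrete random variables *)

Section DiscreteVariables.
Context (d : measure_display) (Omega : measurableType d).

Lemma discrete_rv_cst (T : Type) (t : T) : discrete_rv (fun _ : Omega => t).
Proof.
move=> B; have [tB|tB] := pselect (B t).
  by rewrite (_ : _ @^-1` _ = setT)//; apply/seteqP; split.
by rewrite (_ : _ @^-1` _ = set0)//; apply/seteqP; split.
Qed.

(** Countability of [T] splits the preimage over the values of [X]. [Y] takes both arguments because
    the progeny of a random generation is read off the same [w] that produced the generation. *)
Lemma discrete_rv_bind (T : countType) (U : Type) (X : Omega -> T)
    (Y : T -> Omega -> U) :
  discrete_rv X -> (forall t, discrete_rv (Y t)) ->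
  discrete_rv (fun w => Y (X w) w).
Proof.
move=> mX mY B.
rewrite (_ : _ @^-1` B = \bigcup_k
   (if unpickle k is Some t then X @^-1` [set t] `&` Y t @^-1` B else set0)).
  apply: bigcup_measurable => k _; case: unpickle => // t.
  by apply: measurableI; [exact: mX|exact: mY].
apply/seteqP; split => [w Bw|w [k _]].
  by exists (pickle (X w)) => //; rewrite pickleK.
by case: unpickle => //= t [<-].
Qed.

Lemma discrete_rv_comp (T : countType) (U : Type) (X : Omega -> T) (f : T -> U) :
  discrete_rv X -> discrete_rv (f \o X).
Proof.
move=> mX; apply: (@discrete_rv_bind _ _ X (fun t _ => f t)) => // t.
exact: discrete_rv_cst.
Qed.

Lemma discrete_rv_measurable (R : realType) (X : Omega -> R) :
  discrete_rv X -> measurable_fun setT X.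
Proof. by move=> mX _ B _; rewrite setTI; exact: mX. Qed.

Context (R : realType) (P : probability Omega R).

Lemma integral_discrete (T : countType) (X : Omega -> T) (D : set Omega)
    (F : Omega -> \bar R) :
  discrete_rv X -> measurable D -> measurable_fun setT F ->
  (forall w, (0 <= F w)%E) ->
  (\int[P]_(w in D) F w =
   \sum_(0 <= k <oo) \int[P]_(w in D `&` [set w | pickle (X w) = k]) F w)%E.
Proof.
move=> mX mD mF F0.
have DE : D = \bigcup_k (D `&` [set w | pickle (X w) = k]).
  by apply/seteqP; split => [w Dw|w [k _ []//]]; exists (pickle (X w)).
rewrite {1}DE; apply: ge0_integral_bigcup => //.
- by move=> k; apply: measurableI => //; exact: (mX [set t | pickle t = k]).
- by rewrite -DE; apply: measurable_funTS.
- apply/trivIsetP => i j _ _ /eqP ij; apply/seteqP.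
  by split => // w [[_ /= wi] [_ /= wj]]; apply: ij; rewrite -wi.
Qed.

(** Stands in for conditioning on [X]: the integrals are compared on each atom [X = t]. In the
    branching formula [X] is the progeny of one individual and [D] an event about others. *)
Lemma eq_integral_discrete (T : countType) (X : Omega -> T) (D D' : set Omega)
    (F H : Omega -> \bar R) (c : R) :
  discrete_rv X -> measurable D -> measurable D' ->
  measurable_fun setT F -> measurable_fun setT H ->
  (forall w, (0 <= F w)%E) -> (forall w, (0 <= H w)%E) -> 0 <= c ->
  (forall t, \int[P]_(w in D `&` [set w | X w = t]) F w =
     c%:E * \int[P]_(w in D' `&` [set w | X w = t]) H w)%E ->
  (\int[P]_(w in D) F w = c%:E * \int[P]_(w in D') H w)%E.
Proof.
move=> mX mD mD' mF mH F0 H0 c0 FH.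
rewrite (integral_discrete mX mD mF F0) (integral_discrete mX mD' mH H0).
rewrite -nneseriesZl//; last by move=> *; exact: integral_ge0.
apply: eq_eseriesr => k _.
have [[t tk]|nt] := pselect (exists t : T, pickle t = k).
  have E w : (pickle (X w) = k) = (X w = t).
    by apply/propext; rewrite -tk; split => [/(pcan_inj (@pickleK T))|-> //].
  by rewrite (_ : [set w | pickle (X w) = k] = [set w | X w = t]) ?FH//;
    apply/seteqP; split => w /=; rewrite E.
rewrite (_ : [set w | pickle (X w) = k] = set0) ?setI0 ?integral_set0 ?mule0//.
by apply/seteqP; split => // w /= Xk; apply: nt; exists (X w).
Qed.

Lemma integral_discrete_esum (T : countType) (X : Omega -> T) (h : T -> R) :
  discrete_rv X -> (forall t, 0 <= h t) ->
  (\int[P]_w (h (X w))%:E =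
   \esum_(t in [set: T]) (P [set w | X w = t] * (h t)%:E))%E.
Proof.
move=> mX h0.
have mh : measurable_fun setT (fun w => (h (X w))%:E).
  apply/measurable_EFinP; apply: discrete_rv_measurable.
  exact: (discrete_rv_comp h mX).
rewrite (integral_discrete mX)//; last by move=> w; rewrite lee_fin.
have TE : [set: T] = \bigcup_k [set t | pickle t = k].
  by apply/seteqP; split => // t _; exists (pickle t).
have ph0 t : (0 <= P [set w | X w = t] * (h t)%:E)%E.
  by apply: mule_ge0 => //; rewrite lee_fin.
rewrite TE esum_bigcupT//; last first.
  apply/trivIsetP => i j _ _ /eqP ij; apply/seteqP.
  by split => // t [/= ti tj]; apply: ij; rewrite -ti.
rewrite nneseries_esumT; last first.
  by move=> k; apply: integral_ge0 => w _; rewrite lee_fin.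
apply: eq_esum => k _; rewrite setTI.
have [[t tk]|nt] := pselect (exists t : T, pickle t = k).
  rewrite (_ : [set t | pickle t = k] = [set t]); last first.
    apply/seteqP; split => t' /=; rewrite -tk; last by move=> ->.
    exact: (pcan_inj (@pickleK T)).
  rewrite esum_set1//.
  rewrite (_ : [set w | pickle (X w) = k] = [set w | X w = t]); last first.
    apply/seteqP; split => w /=; rewrite -tk; last by move=> ->.
    exact: (pcan_inj (@pickleK T)).
  rewrite (eq_integral (fun=> (h t)%:E)); last by move=> w; rewrite inE /= => ->.
  by rewrite integral_cst 1?muleC//; exact: (mX [set t]).
rewrite (_ : [set w | _] = set0); last first.
  by apply/seteqP; split => // w /= Xk; apply: nt; exists (X w).
rewrite (_ : [set t | _] = set0); last first.
  by apply/seteqP; split => // t /= Xk; apply: nt; exists t.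
by rewrite integral_set0 esum_set0.
Qed.

End DiscreteVariables.

(** * Monomials on the unit cube *)

Definition monomial (R : realType) i (s : nat -> R) (r : progeny i) : R :=
  \prod_(k < i.+2) s k ^+ r k.

Definition unit_vector (R : realType) (s : nat -> R) := forall k, 0 <= s k <= 1.

Section Monomials.
Context (R : realType) (i : nat).
Implicit Types (s x y : nat -> R) (r : progeny i).

Lemma monomial_unit s r : unit_vector s -> 0 <= monomial s r <= 1.
Proof.
move=> s1; apply/andP; split.
  by apply: prodr_ge0 => k _; apply: exprn_ge0; case/andP: (s1 k).
apply: prodr_ile1 => k _; case/andP: (s1 k) => s0 s1k.
by rewrite exprn_ge0//= exprn_ile1.
Qed.

Lemma le_monomial x y r : unit_vector x -> (forall k, x k <= y k) ->
  monomial x r <= monomial y r.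
Proof.
move=> x1 xy; apply: ler_prod => k _; case/andP: (x1 k) => x0 _.
by rewrite exprn_ge0//= lerXn2r// nnegrE// (le_trans x0).
Qed.

Lemma monomialM x y r : monomial (fun k => x k * y k) r = monomial x r * monomial y r.
Proof. by rewrite /monomial -big_split/=; apply: eq_bigr => k _; rewrite exprMn. Qed.

Lemma monomial1 r : monomial (fun=> 1 : R) r = 1.
Proof. by rewrite /monomial big1// => k _; rewrite expr1n. Qed.

(** For two factors, the chord of the product exceeds the product of the chords by
    [t (1 - t) (b - a) (b' - a')], nonnegative thanks to the ordering. [Q] carries order and signs
    along with the bound, to be stable under products. *)
Lemma monomial_convex x y (t : R) r : 0 <= t <= 1 -> unit_vector x ->
  (forall k, x k <= y k) ->
  monomial (fun k => (1 - t) * x k + t * y k) r <=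
    (1 - t) * monomial x r + t * monomial y r.
Proof.
move=> /andP[t0 t1] x1 xy; rewrite /monomial.
pose Q (a b c : R) := [/\ 0 <= a, a <= b, 0 <= c & c <= (1 - t) * a + t * b].
have Q1 : Q 1 1 1 by rewrite /Q; split; lra.
have QM a b c a' b' c' : Q a b c -> Q a' b' c' -> Q (a * a') (b * b') (c * c').
  move=> [a0 ab c0 cab] [a'0 ab' c'0 cab'].
  split; [exact: mulr_ge0|exact: ler_pM|exact: mulr_ge0|].
  apply: (le_trans (ler_pM c0 c'0 cab cab')).
  have : 0 <= t * (1 - t) * ((b - a) * (b' - a')).
    by rewrite !mulr_ge0 ?subr_ge0.
  nra.
have QX a b c n : Q a b c -> Q (a ^+ n) (b ^+ n) (c ^+ n).
  by move=> Qa; elim: n => [|n IH]; rewrite ?expr0// !exprS; exact: QM.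
suff [] : Q (\prod_(k < i.+2) x k ^+ r k) (\prod_(k < i.+2) y k ^+ r k)
  (\prod_(k < i.+2) ((1 - t) * x k + t * y k) ^+ r k) by [].
apply: (big_ind3 Q Q1) => [*|k _]; first exact: QM.
apply: QX; case/andP: (x1 k) => x0 _; have := xy k => xyk; split => //.
by rewrite addr_ge0// mulr_ge0//; lra.
Qed.

Lemma monomial_lipschitz x y (e : R) r : 0 <= e -> unit_vector x -> unit_vector y ->
  (forall k : 'I_i.+2, `|x k - y k| <= e) ->
  `|monomial x r - monomial y r| <= (progeny_size r)%:R * e.
Proof.
move=> e0 x1 y1 xy; rewrite /monomial /progeny_size.
pose Q (a b : R) (n : nat) := [/\ `|a| <= 1, `|b| <= 1 & `|a - b| <= n%:R * e].
have QM a b n a' b' n' : Q a b n -> Q a' b' n' -> Q (a * a') (b * b') (n + n')%N.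
  move=> [a1 b1 ab] [a'1 b'1 ab']; split; rewrite ?normrM ?mulr_ile1//.
  rewrite (_ : a * a' - b * b' = a * (a' - b') + (a - b) * b'); last by ring.
  apply: (le_trans (ler_normD _ _)); rewrite !normrM natrD mulrDl addrC.
  apply: lerD.
    by rewrite -[leRHS]mulr1 ler_pM.
  by rewrite -[leRHS]mul1r ler_pM.
have Q1 : Q 1 1 0%N by rewrite /Q subrr !normr1 normr0 mul0r; split.
suff [] : Q (\prod_(k < i.+2) x k ^+ r k) (\prod_(k < i.+2) y k ^+ r k)
  (\sum_l r l)%N by [].
apply: (big_ind3 Q Q1) => [*|k _]; first exact: QM.
have Qk : Q (x k) (y k) 1%N.
  case/andP: (x1 k) => ? ?; case/andP: (y1 k) => ? ?.
  by rewrite /Q mul1r; split; [rewrite ger0_norm|rewrite ger0_norm|exact: xy].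
elim: (r k) => [|n IH]; first by rewrite !expr0.
by rewrite !exprS; exact: (QM _ _ 1%N _ _ n).
Qed.

Lemma monomial_eq1 s r : unit_vector s -> monomial s r = 1 ->
  forall k : 'I_i.+2, (0 < r k)%N -> s k = 1.
Proof.
move=> s1 sr k rk; case/andP: (s1 k) => s0k s1k.
have [//|sk] := eqVneq (s k) 1.
have {}sk : s k < 1 by rewrite lt_neqAle sk.
have : monomial s r < 1; last by rewrite sr ltxx.
rewrite /monomial (bigD1 k)//=; apply: (@le_lt_trans _ _ (s k ^+ r k)).
  rewrite -[leRHS]mulr1 ler_wpM2l ?exprn_ge0// prodr_ile1// => l _.
  by case/andP: (s1 l) => ? ?; rewrite exprn_ge0//= exprn_ile1.
by rewrite exprn_ilt1// -lt0n.
Qed.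

Lemma monomial_le_coord s r : unit_vector s ->
  forall k : 'I_i.+2, (0 < r k)%N -> monomial s r <= s k.
Proof.
move=> s1 k rk; case/andP: (s1 k) => s0k s1k.
rewrite /monomial (bigD1 k)//= -[leRHS]mulr1.
apply: ler_pM => //; first exact: exprn_ge0.
- by apply: prodr_ge0 => l _; rewrite exprn_ge0//; case/andP: (s1 l).
- by case: (r k) rk => // n _; rewrite exprS -[leRHS]mulr1 ler_wpM2l// exprn_ile1.
- by apply: prodr_ile1 => l _; case/andP: (s1 l) => ? ?; rewrite exprn_ge0//= exprn_ile1.
Qed.

(** A vanishing factor would hide a strict inequality at another coordinate; positivity of the
    smaller monomial excludes this. *)
Lemma monomial_eq_coord x y r : (forall k, 0 <= x k <= y k) ->
  0 < monomial x r -> monomial x r = monomial y r ->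
  forall k : 'I_i.+2, (0 < r k)%N -> x k = y k.
Proof.
move=> xy x0 xyr k rk; have xk0 (l : 'I_i.+2) : 0 < x l ^+ r l.
  rewrite lt_neqAle exprn_ge0 ?andbT; last by case/andP: (xy l).
  apply/eqP => /esym xl; move: x0.
  by rewrite /monomial (bigD1 l)//= xl mul0r ltxx.
case/andP: (xy k) => x0k; rewrite le_eqVlt => /predU1P[//|xyk].
have : monomial x r < monomial y r; last by rewrite xyr ltxx.
rewrite /monomial (bigD1 k)//= [ltRHS](bigD1 k)//=.
apply: (@lt_le_trans _ _ (y k ^+ r k * \prod_(j < i.+2 | j != k) x j ^+ r j)).
  rewrite ltr_pM2r; first by rewrite ltr_pXn2r// nnegrE// (le_trans x0k (ltW xyk)).
  by apply: prodr_gt0 => l _.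
apply: ler_wpM2l; first by rewrite exprn_ge0// (le_trans x0k (ltW xyk)).
apply: ler_prod => l _; case/andP: (xy l) => ? ?.
by rewrite exprn_ge0//= lerXn2r// nnegrE (le_trans _ (_ : x l <= _)).
Qed.

Lemma monomial_cst (c : R) r : monomial (fun=> c) r = c ^+ progeny_size r.
Proof. by rewrite /monomial /progeny_size expr_sum. Qed.

End Monomials.

(** * Integrals of functions with values in the unit interval *)

Section BoundedIntegrable.
Context d (Omega : measurableType d) (R : realType) (P : probability Omega R).

Lemma integrable_unit (f : Omega -> R) : measurable_fun setT f ->
  (forall w, 0 <= f w <= 1) -> P.-integrable setT (EFin \o f).
Proof.
move=> mf f1; apply: measurable_bounded_integrable => //.
  by rewrite (le_lt_trans (@probability_le1 _ _ _ P _ measurableT))// ltry.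
exists 1; split; first exact: num_real.
move=> M M1 w _ /=; case/andP: (f1 w) => ? ?.
by rewrite ger0_norm// (le_trans _ (ltW M1)).
Qed.

Lemma integrable_EFinZ (c : R) (f : Omega -> R) : P.-integrable setT (EFin \o f) ->
  P.-integrable setT (EFin \o (fun w => c * f w)).
Proof. by move=> fi; exact: (integrableZl measurableT c fi). Qed.

Lemma integrable_EFinD (f g : Omega -> R) : P.-integrable setT (EFin \o f) ->
  P.-integrable setT (EFin \o g) -> P.-integrable setT (EFin \o (fun w => f w + g w)).
Proof. by move=> fi gi; exact: (integrableD measurableT fi gi). Qed.

Lemma integrable_EFinB (f g : Omega -> R) : P.-integrable setT (EFin \o f) ->
  P.-integrable setT (EFin \o g) -> P.-integrable setT (EFin \o (fun w => f w - g w)).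
Proof. by move=> fi gi; exact: (integrableB measurableT fi gi). Qed.

Lemma Rintegral_probability_cst (c : R) : \int[P]_w c = c.
Proof.
rewrite Rintegral_cst//.
by rewrite [X in fine X](_ : _ = 1%E) ?mulr1//; exact: probability_setT.
Qed.

Lemma Rintegral_unit (f : Omega -> R) : measurable_fun setT f ->
  (forall w, 0 <= f w <= 1) -> 0 <= \int[P]_w f w <= 1.
Proof.
move=> mf f1; apply/andP; split.
  by apply: Rintegral_ge0 => w _; case/andP: (f1 w).
rewrite -[leRHS]Rintegral_probability_cst; apply: le_Rintegral => //.
- exact: integrable_unit.
- by apply: integrable_unit; [exact: measurable_cst|move=> w; rewrite ler01 lexx].
- by move=> w _; case/andP: (f1 w).
Qed.

Lemma EFin_Rintegral_unit (f : Omega -> R) : measurable_fun setT f ->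
  (forall w, 0 <= f w <= 1) -> ((\int[P]_w f w)%:E = \int[P]_w (f w)%:E)%E.
Proof.
move=> mf f1; rewrite fineK//; apply: integrable_fin_num => //.
exact: integrable_unit.
Qed.

End BoundedIntegrable.

(** * The progeny generating operator *)

Section GeneratingOperator.
Context (R : realType) (p : forall i : nat, progeny i -> R).
Context (p_law : is_progeny_law p).
Context (d : measure_display) (Omega : measurableType d) (P : probability Omega R).
Context (xi : forall u : indiv, Omega -> progeny (itype u)).
Context (xi_family : is_progeny_family P xi p).

Lemma xi_discrete u : discrete_rv (xi u).
Proof. by move=> B; exact: (progeny_family_meas xi_family). Qed.

Lemma p_ge0 i (r : progeny i) : 0 <= p r.
Proof. by case: p_law. Qed.

Lemma xi_comp_measurable u (h : progeny (itype u) -> R) :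
  measurable_fun setT (h \o xi u).
Proof. by apply: discrete_rv_measurable; exact: (discrete_rv_comp h (@xi_discrete u)). Qed.

Lemma G_integral u (s : nat -> R) : unit_vector s ->
  G p s (itype u) = \int[P]_w monomial s (xi u w).
Proof.
move=> s1; rewrite /G /Rintegral; congr fine.
rewrite (integral_discrete_esum P (h := monomial s) (@xi_discrete u)); last first.
  by move=> r; case/andP: (monomial_unit r s1).
apply: eq_esum => r _; rewrite EFinM; congr (_ * _)%E.
by rewrite (progeny_family_law xi_family).
Qed.

(* Expectations over the law p_i are integrals on Omega of functions of the
   progeny of the founder of type i. *)
Let founder i : indiv := [:: (i, 0%N)].
Let X i : Omega -> progeny i := xi (founder i).

Let GE i s : unit_vector s -> G p s i = \int[P]_w monomial s (X i w).
Proof. exact: (@G_integral (founder i)). Qed.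

Let mX i (h : progeny i -> R) : measurable_fun setT (fun w => h (X i w)).
Proof. exact: (@xi_comp_measurable (founder i)). Qed.

Let iX i (h : progeny i -> R) : (forall r, 0 <= h r <= 1) ->
  P.-integrable setT (EFin \o (fun w => h (X i w))).
Proof. by move=> h1; apply: integrable_unit => //; exact: mX. Qed.

Let imon i s : unit_vector s -> P.-integrable setT (EFin \o (fun w => monomial s (X i w))).
Proof. by move=> s1; apply: (@iX i (monomial s)) => r; exact: monomial_unit. Qed.

Lemma G_unit s : unit_vector s -> unit_vector (G p s).
Proof.
move=> s1 i; rewrite GE//; apply: Rintegral_unit => [|w]; last exact: monomial_unit.
exact: (mX (monomial s)).
Qed.

Lemma unit_vector1 : unit_vector (fun=> 1 : R).
Proof. by move=> k; rewrite ler01 lexx. Qed.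

Lemma G1 : G p (fun=> 1) = (fun=> 1).
Proof.
apply/funext => i; rewrite GE; last exact: unit_vector1.
rewrite -[RHS](Rintegral_probability_cst P); apply: eq_Rintegral => w _.
exact: monomial1.
Qed.

Lemma le_G x y : unit_vector x -> unit_vector y -> (forall k, x k <= y k) ->
  forall i, G p x i <= G p y i.
Proof.
move=> x1 y1 xy i; rewrite !GE//; apply: le_Rintegral => //; [exact: imon|exact: imon|].
by move=> w _; exact: le_monomial.
Qed.

Lemma G_convex x y (t : R) i : 0 <= t <= 1 -> unit_vector x -> unit_vector y ->
  (forall k, x k <= y k) ->
  G p (fun k => (1 - t) * x k + t * y k) i <= (1 - t) * G p x i + t * G p y i.
Proof.
move=> t1 x1 y1 xy; have z1 : unit_vector (fun k => (1 - t) * x k + t * y k).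
  move=> k; case/andP: t1 => ? ?; case/andP: (x1 k) => ? ?; case/andP: (y1 k) => ? ?.
  by rewrite addr_ge0 ?mulr_ge0//=; nra.
rewrite !GE// -!RintegralZl//; try exact: imon.
have iZ (c : R) s : unit_vector s ->
    P.-integrable setT (EFin \o (fun w => c * monomial s (X i w))).
  by move=> s1; apply: integrable_EFinZ; exact: imon.
rewrite -RintegralD//; try exact: iZ.
apply: le_Rintegral => //; first exact: imon.
  by apply: integrable_EFinD => //; exact: iZ.
by move=> w _; exact: monomial_convex.
Qed.

(** Makes a vanishing mean pointwise: a nonnegative function of mean at most 0 is 0 at every progeny
    of positive probability. The equality cases below rest on it. *)
Lemma expectation_ge_atom i (h : progeny i -> R) (r : progeny i) :
  (forall r, 0 <= h r) -> P.-integrable setT (EFin \o (fun w => h (X i w))) ->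
  p r * h r <= \int[P]_w h (X i w).
Proof.
move=> h0 ih; rewrite -lee_fin fineK; last exact: integrable_fin_num.
rewrite (integral_discrete_esum P (@xi_discrete (founder i)) h0).
apply: esum_ge; exists [set r]; first by split.
rewrite fsbig_set1 EFinM; apply: lee_wpmul2r; first by rewrite lee_fin.
by rewrite (progeny_family_law xi_family).
Qed.

Lemma eq_monomial_of_G x y i : unit_vector x -> unit_vector y ->
  (forall k, x k <= y k) -> G p y i <= G p x i ->
  forall r : progeny i, 0 < p r -> monomial x r = monomial y r :> R.
Proof.
move=> x1 y1 xy; rewrite !GE// -subr_le0 -RintegralB//; try exact: imon.
move=> le0 r pr; have h0 (r' : progeny i) : 0 <= monomial y r' - monomial x r' :> R.
  by rewrite subr_ge0 le_monomial.
have ih : P.-integrable setT (EFin \o (fun w => monomial y (X i w) - monomial x (X i w))).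
  apply: (@iX i (fun r => monomial y r - monomial x r)) => r'.
  case/andP: (monomial_unit r' x1) => ? ?; case/andP: (monomial_unit r' y1) => ? ?.
  by rewrite h0/=; lra.
have := le_trans (@expectation_ge_atom i (fun r => monomial y r - monomial x r) r h0 ih) le0.
rewrite pmulr_rle0// => /(conj (h0 r))/andP/le_anti/esym/eqP.
by rewrite subr_eq0 => /eqP.
Qed.

(** The left side is the variance of the monomial, whose square is the monomial of the squares. Its
    sign gives Jensen's inequality, its vanishing the equality case. *)
Let square_dev x i : unit_vector x ->
  \int[P]_w (monomial x (X i w) - G p x i) ^+ 2 = G p (fun k => x k ^+ 2) i - G p x i ^+ 2
  /\ P.-integrable setT (EFin \o (fun w => (monomial x (X i w) - G p x i) ^+ 2)).
Proof.
move=> x1; have x21 : unit_vector (fun k => x k ^+ 2).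
  by move=> k; case/andP: (x1 k) => ? ?; rewrite exprn_ge0//= exprn_ile1.
have g1 := G_unit x1 i; set g := G p x i in g1 *.
have E w : (monomial x (X i w) - g) ^+ 2 =
    monomial (fun k => x k ^+ 2) (X i w) + (g ^+ 2 - 2 * g * monomial x (X i w)).
  rewrite [monomial (fun k => x k ^+ 2) _]
    (_ : _ = monomial x (X i w) * monomial x (X i w)); last first.
    rewrite -monomialM; congr monomial; apply/funext => k; exact: expr2.
  by ring.
have ig : P.-integrable setT (EFin \o (fun=> g ^+ 2)).
  apply: (@iX i (fun=> g ^+ 2)) => _; case/andP: g1 => ? ?.
  by rewrite exprn_ge0//= exprn_ile1.
have iZ : P.-integrable setT (EFin \o (fun w => 2 * g * monomial x (X i w))).
  by apply: integrable_EFinZ; exact: imon.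
have iB : P.-integrable setT (EFin \o (fun w => g ^+ 2 - 2 * g * monomial x (X i w))).
  exact: integrable_EFinB.
have iD : P.-integrable setT (EFin \o (fun w => (monomial x (X i w) - g) ^+ 2)).
  rewrite (_ : (fun w => _) = (fun w => monomial (fun k => x k ^+ 2) (X i w) +
    (g ^+ 2 - 2 * g * monomial x (X i w)))); last by apply/funext => w; rewrite E.
  by apply: integrable_EFinD => //; exact: imon.
split => //; under eq_Rintegral do rewrite E.
rewrite RintegralD//; last exact: imon.
rewrite RintegralB// RintegralZl//; last exact: imon.
by rewrite Rintegral_probability_cst -!GE// -/g; ring.
Qed.

Lemma G_jensen x i : unit_vector x -> G p x i ^+ 2 <= G p (fun k => x k ^+ 2) i.
Proof.
move=> x1; have [E _] := square_dev i x1; rewrite -subr_ge0 -E.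
by apply: Rintegral_ge0 => w _; exact: sqr_ge0.
Qed.

Lemma G_jensen_eq x i : unit_vector x -> G p (fun k => x k ^+ 2) i <= G p x i ^+ 2 ->
  forall r : progeny i, 0 < p r -> monomial x r = G p x i.
Proof.
move=> x1; have [E iD] := square_dev i x1; rewrite -subr_le0 -E => le0 r pr.
have := le_trans (@expectation_ge_atom i (fun r => (monomial x r - G p x i) ^+ 2) r
  (fun r => sqr_ge0 _) iD) le0.
rewrite pmulr_rle0// => /(conj (sqr_ge0 (monomial x r - G p x i)))/andP/le_anti/esym/eqP.
by rewrite sqrf_eq0 subr_eq0 => /eqP.
Qed.

Lemma G_eq1 x i : unit_vector x -> G p x i = 1 ->
  forall r : progeny i, 0 < p r -> monomial x r = 1 :> R.
Proof.
move=> x1 Gx r pr; rewrite -(monomial1 R r); apply: (@eq_monomial_of_G _ _ i) => //.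
- exact: unit_vector1.
- by move=> k; case/andP: (x1 k).
- by rewrite Gx G1.
Qed.

Lemma progeny_size_tail i (e : R) : 0 < e -> exists M,
  fine (P [set w | (M < progeny_size (X i w))%N]) <= e.
Proof.
move=> e0; pose A M := [set w | (M < progeny_size (X i w))%N].
have mA M : measurable (A M).
  exact: (@xi_discrete (founder i) [set r | (M < progeny_size r)%N]).
have A0 : \bigcap_M A M = set0.
  apply/seteqP; split => // w /(_ (progeny_size (X i w)) I) /=.
  by rewrite /A/= ltnn.
have : P (A M) @[M --> \oo] --> P (\bigcap_M A M).
  apply: nonincreasing_cvg_mu => //.
  - by rewrite (le_lt_trans (@probability_le1 _ _ _ P _ (mA _)))// ltry.
  - by rewrite A0.
  - by move=> m n mn; apply/subsetPset => w /= /(leq_ltn_trans mn).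
rewrite A0 measure0 => /fine_cvgP[_ /cvgrPdist_le/(_ e e0)[M _ /(_ M (leqnn M))]].
rewrite sub0r normrN /= => H; exists M.
by rewrite (le_trans _ H)// ler_norm.
Qed.

(** The Lipschitz constant of a monomial is the progeny size, whose mean may be infinite; hence the
    cut at a size [M] with tail probability at most [e / 2]. The filter is arbitrary so that
    ultrafilters are covered. *)
Lemma cvg_G (T : Type) (F : set_system T) {FF : Filter F} (x : T -> nat -> R) s i :
  (\forall n \near F, unit_vector (x n)) -> unit_vector s ->
  (forall k, (k <= i.+1)%N -> x n k @[n --> F] --> s k) ->
  G p (x n) i @[n --> F] --> G p s i.
Proof.
move=> x1 s1 xs; apply/cvgrPdist_le => e e0.
have e20 : 0 < e / 2 by rewrite divr_gt0.
have [M PM] := progeny_size_tail i e20.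
set A := [set w | (M < progeny_size (X i w))%N] in PM.
have mA : measurable A := @xi_discrete (founder i) [set r | (M < progeny_size r)%N].
(* A progeny of size at most [M] then contributes at most [M * dl <= e / 2]; [M.+1] avoids dividing
   by 0. *)
pose dl := e / 2 / M.+1%:R.
have dl0 : 0 < dl by rewrite !divr_gt0.
have : \forall n \near F, forall k : 'I_i.+2, `|s k - x n k| <= dl.
  by apply: filter_forall => k; move/cvgrPdist_le: (xs k (ltn_ord k)); exact.
apply: filterS2 x1 => n x1 nk; rewrite !GE// -RintegralB//; try exact: imon.
have imonB : P.-integrable setT
    (EFin \o (fun w => monomial s (X i w) - monomial (x n) (X i w))).
  by apply: integrable_EFinB; exact: imon.
have iA : P.-integrable setT (EFin \o (fun w => \1_A w)).
  apply: integrable_unit => [|w]; first exact: measurable_indic.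
  by rewrite indicE; case: (_ \in _); rewrite ler01 lexx.
have iC : P.-integrable setT (EFin \o (fun=> e / 2)).
  exact: finite_measure_integrable_cst.
apply: (le_trans (le_normr_Rintegral measurableT imonB)).
apply: (@le_trans _ _ (\int[P]_w (e / 2 + \1_A w))); last first.
  rewrite RintegralD// Rintegral_probability_cst.
  rewrite [X in _ + X](_ : _ = fine (P A)); last by rewrite /Rintegral integral_indic// setIT.
  by rewrite [leRHS](splitr e) lerD2l.
apply: le_Rintegral => //; first exact: (integrable_norm imonB).
  exact: integrable_EFinD.
move=> w _; rewrite indicE; case: (boolP (w \in A)) => wA.
  rewrite (@le_trans _ _ 1)//; last by rewrite lerDr ltW.
  case/andP: (monomial_unit (X i w) s1) => ? ?.
  case/andP: (monomial_unit (X i w) x1) => ? ?.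
  by rewrite ler_norml; apply/andP; split; lra.
rewrite addr0; have := @monomial_lipschitz _ i _ _ _ (X i w) (ltW dl0) s1 x1 nk.
move=> /le_trans; apply.
have XM : (progeny_size (X i w) <= M)%N.
  by rewrite leqNgt; apply: contra wA => wA; rewrite inE.
rewrite /dl mulrA ler_pdivrMr// mulrC ler_pM2l// ler_nat.
exact: leqW.
Qed.

(** By contraposition: if no progeny of positive probability contains type [j], then [G_i] does not
    depend on [s_j], and the difference quotient is identically 0. *)
Lemma mean_progeny_gt0 i j : (0 < mean_progeny p i j)%E ->
  exists (r : progeny i) (k : 'I_i.+2), [/\ 0 < p r, k = j :> nat & (0 < r k)%N].
Proof.
move=> M0; apply/not_existsP => nr; move: M0; rewrite /mean_progeny.
rewrite (_ : (fun t => _) = fun=> 0%E) ?lim_cst ?ltxx//.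
apply/funext => t; rewrite (_ : G p _ i - G p _ i = 0) ?mul0r//; apply/eqP.
rewrite subr_eq0; apply/eqP; congr fine; apply: eq_esum => r _; congr EFin.
have := p_ge0 r; rewrite le_eqVlt => /predU1P[<-|pr]; first by rewrite !mul0r.
congr (_ * _); apply: eq_bigr => k _; rewrite /= if_same; case: ifP => // /eqP kj.
have rk : r k = 0%N.
  apply/eqP; rewrite -leqn0 leqNgt; apply/negP => rk.
  by apply: (nr r); exists k.
by rewrite rk !expr0.
Qed.

Context (irr : irreducible_type_graph p).

(** The form in which irreducibility is used: a property inherited by every child that occurs with
    positive probability spreads from one type to all. *)
Lemma irreducible_ind (Q : nat -> Prop) :
  (forall i (r : progeny i) (k : 'I_i.+2), 0 < p r -> (0 < r k)%N -> Q i -> Q k) ->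
  forall i, Q i -> forall j, Q j.
Proof.
move=> Qstep i Qi j; have [w [iw <-]] := irr i j.
elim: w i Qi iw => [//|k w IH] i Qi /= /andP[/mean_progeny_gt0[r [k' [pr k'k rk]]] kw].
by apply: IH => //; rewrite -k'k; exact: Qstep pr rk Qi.
Qed.

Lemma fixed_point_lt1 s : fixed_points p s -> s <> (fun=> 1) -> forall i, s i < 1.
Proof.
move=> [s1 sG] sN1 i; rewrite lt_neqAle; case/andP: (s1 i) => _ ->; rewrite andbT.
apply/eqP => si; apply: sN1; apply/funext.
apply: (irreducible_ind _ si) => j r k pr rk sj.
apply: (monomial_eq1 s1 _ rk); apply: (@G_eq1 s j) => //.
by rewrite -sG.
Qed.

End GeneratingOperator.

(** * Products over the first generations *)

(** Starts from any list of individuals, not only from a founder, so that the branching property can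
    be expressed through concatenation of lists. *)
Definition offspring (x : forall u : indiv, progeny (itype u)) (L : seq indiv) :
    seq indiv :=
  flatten [seq [seq c :: u | c <- brood x u] | u <- L].

Lemma offspring_cat x L1 L2 :
  offspring x (L1 ++ L2) = offspring x L1 ++ offspring x L2.
Proof. by rewrite /offspring map_cat flatten_cat. Qed.

Lemma iter_offspring_cat x n L1 L2 : iter n (offspring x) (L1 ++ L2) =
  iter n (offspring x) L1 ++ iter n (offspring x) L2.
Proof. by elim: n => //= n ->; rewrite offspring_cat. Qed.

Lemma generation_iter x i n :
  generation (brood x) i n = iter n (offspring x) [:: [:: (i, 0%N)]].
Proof. by elim: n => //= n ->. Qed.

Lemma children_uniq i (r : progeny i) : uniq (children r).
Proof.
apply: allpairs_uniq_dep => [|l _|]; [exact: enum_uniq|exact: iota_uniq|].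
by move=> [l m] [l' m'] _ _ /= [/val_inj -> ->].
Qed.

Section Weights.
Context (R : realType).
Implicit Types (f : nat -> nat -> R) (h : nat -> R).

Definition weight h (L : seq indiv) : R := \prod_(u <- L) h (itype u).

(** With [f = 1] this is the martingale candidate [prod h] at time [n]; with 0-1 weights it is the
    indicator of an event about the first [n] generations. It is multiplicative in [L], which makes
    its mean computable. *)
Definition history_weight f n h (x : forall u : indiv, progeny (itype u)) L : R :=
  (\prod_(m < n) weight (f m) (iter m (offspring x) L)) *
  weight h (iter n (offspring x) L).

Lemma weight_unit h L : unit_vector h -> 0 <= weight h L <= 1.
Proof.
move=> h1; apply/andP; split; first by apply: prodr_ge0 => u _; case/andP: (h1 (itype u)).
by apply: prodr_ile1 => u _; exact: h1.
Qed.

Lemma weight_cat h L1 L2 : weight h (L1 ++ L2) = weight h L1 * weight h L2.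
Proof. by rewrite /weight big_cat. Qed.

Lemma weight_children h i (r : progeny i) u :
  weight h [seq c :: u | c <- children r] = monomial h r.
Proof.
rewrite /weight big_map /children big_allpairs_dep /monomial big_enum/=.
apply: eq_bigr => l _.
rewrite (eq_bigr (fun=> h l)); last by [].
by rewrite big_const_seq count_predT size_iota -Monoid.iteropE.
Qed.

Lemma history_weight_unit f n h x L : (forall m, unit_vector (f m)) ->
  unit_vector h -> 0 <= history_weight f n h x L <= 1.
Proof.
move=> f1 h1; have /andP[h0 h1'] := weight_unit (iter n (offspring x) L) h1.
have F0 : 0 <= \prod_(m < n) weight (f m) (iter m (offspring x) L) <= 1.
  apply/andP; split.
    by apply: prodr_ge0 => m _; case/andP: (weight_unit (iter m (offspring x) L) (f1 m)).
  by apply: prodr_ile1 => m _; exact: weight_unit.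
by case/andP: F0 => ? ?; rewrite mulr_ge0//= mulr_ile1.
Qed.

Lemma history_weight_cat f n h x L1 L2 :
  history_weight f n h x (L1 ++ L2) =
  history_weight f n h x L1 * history_weight f n h x L2.
Proof.
rewrite /history_weight iter_offspring_cat weight_cat mulrACA; congr (_ * _).
by rewrite -big_split; apply: eq_bigr => m _; rewrite iter_offspring_cat weight_cat.
Qed.

Lemma history_weight_nil f n h x : history_weight f n h x [::] = 1.
Proof.
have E m : iter m (offspring x) [::] = [::] by elim: m => //= m ->.
by rewrite /history_weight E /weight big_nil mulr1 big1// => m _; rewrite E big_nil.
Qed.

Lemma history_weightS f n h x L : history_weight f n.+1 h x L =
  weight (f 0%N) L * history_weight (fun m => f m.+1) n h x (offspring x L).
Proof.
rewrite /history_weight big_ord_recl iterSr -mulrA; congr (_ * (_ * _)).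
by apply: eq_bigr => m _; rewrite iterSr.
Qed.

End Weights.

Section BranchingFormula.
Context (R : realType) (p : forall i : nat, progeny i -> R).
Context (p_law : is_progeny_law p).
Context (d : measure_display) (Omega : measurableType d) (P : probability Omega R).
Context (xi : forall u : indiv, Omega -> progeny (itype u)).
Context (xi_family : is_progeny_family P xi p).
Implicit Types (f : nat -> nat -> R) (h : nat -> R).

Fixpoint history_mean f n h : nat -> R :=
  if n is n'.+1 then fun i => f 0%N i * G p (history_mean (fun m => f m.+1) n' h) i
  else h.

Lemma history_mean_unit f n h : (forall m, unit_vector (f m)) -> unit_vector h ->
  unit_vector (history_mean f n h).
Proof.
elim: n f => //= n IH f f1 h1 i.
have /andP[? ?] := G_unit xi_family (IH _ (fun m => f1 m.+1) h1) i.
by case/andP: (f1 0%N i) => ? ?; rewrite mulr_ge0//= mulr_ile1.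
Qed.

Lemma discrete_rv_offspring L : discrete_rv (fun w => offspring (xi^~ w) L).
Proof.
elim: L => [|u L IH]; first exact: discrete_rv_cst.
apply: (@discrete_rv_bind _ _ _ _ (xi u)
  (fun r w => [seq c :: u | c <- children r] ++ offspring (xi^~ w) L)).
  exact: (xi_discrete xi_family).
by move=> r; exact: (discrete_rv_comp (cat [seq c :: u | c <- children r]) IH).
Qed.

Lemma discrete_rv_iter_offspring m L :
  discrete_rv (fun w => iter m (offspring (xi^~ w)) L).
Proof.
elim: m => [|m IH]; first exact: discrete_rv_cst.
exact: (discrete_rv_bind IH discrete_rv_offspring).
Qed.

Lemma measurable_history_weight f n h L :
  measurable_fun setT (fun w => history_weight f n h (xi^~ w) L).
Proof.
have mW m g : measurable_fun setT (fun w => weight g (iter m (offspring (xi^~ w)) L) : R).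
  apply: discrete_rv_measurable.
  exact: (discrete_rv_comp (weight g) (@discrete_rv_iter_offspring m L)).
apply: measurable_funM => //.
by apply: measurable_prod => m _; exact: mW.
Qed.

(** Conditional means given the progeny of finitely many individuals are encoded as integrals over
    these events. *)
Let cylinder (us : seq indiv) (rho : forall u : indiv, progeny (itype u)) :=
  [set w | forall u, u \in us -> xi u w = rho u].

Let measurable_cylinder us rho : measurable (cylinder us rho).
Proof.
elim: us => [|u us IH].
  by rewrite (_ : cylinder _ _ = setT)//; apply/seteqP; split => // w _ u.
rewrite (_ : cylinder _ _ = xi u @^-1` [set rho u] `&` cylinder us rho).
  by apply: measurableI => //; exact: (xi_discrete xi_family).
apply/seteqP; split => w.
  by move=> H; split=> [|v vus]; apply: H; rewrite inE ?eqxx ?vus ?orbT.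
by move=> [/= xu H] v; rewrite inE => /predU1P[->//|]; exact: H.
Qed.

Let P_cylinder us rho : uniq us -> P (cylinder us rho) = (\prod_(u <- us) p (rho u))%:E.
Proof.
move=> uus; rewrite (progeny_family_indep xi_family (fun u => [set rho u]) uus).
by elim/big_rec2 : _ => //= u x y _ ->; rewrite (progeny_family_law xi_family) EFinM.
Qed.

Let cylinder_cons v us rho (t : progeny (itype v)) : v \notin us ->
  cylinder us rho `&` [set w | xi v w = t] =
  cylinder (v :: us) (@dfwith _ (fun u => progeny (itype u)) rho v t).
Proof.
move=> vus; have neq u : u \in us -> v != u.
  by move=> uus; apply: contraNneq vus => ->.
apply/seteqP; split => w.
  move=> [Hw /= xv] u; rewrite inE => /predU1P[->|uus]; first by rewrite dfwithin.
  by rewrite dfwithout ?neq//; exact: Hw.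
move=> Hw; split => [u uus|/=].
  by rewrite Hw ?inE ?uus ?orbT// dfwithout ?neq.
by rewrite Hw ?inE ?eqxx// dfwithin.
Qed.

Let F_unit f n h L w : (forall m, unit_vector (f m)) -> unit_vector h ->
  (0 <= (history_weight f n h (xi^~ w) L)%:E)%E.
Proof.
by move=> f1 h1; rewrite lee_fin; case/andP: (history_weight_unit n (xi^~ w) L f1 h1).
Qed.

(* The siblings L still have to reveal their progeny, the members of L2 are
   children that were revealed already; both come after the individuals us. *)
Let branching_step n :
  (forall f h us rho l (L : seq indiv),
    (forall m, unit_vector (f m)) -> unit_vector h ->
    uniq us -> uniq L -> (forall u, u \in us -> (size u < l)%N) ->
    (forall u, u \in L -> size u = l) ->
    (\int[P]_(w in cylinder us rho) (history_weight f n h (xi^~ w) L)%:E =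
     (\prod_(u <- us) p (rho u) * weight (history_mean f n h) L)%:E)%E) ->
  forall f h us rho l (L L2 : seq indiv),
    (forall m, unit_vector (f m)) -> unit_vector h ->
    uniq us -> uniq L -> uniq L2 ->
    (forall u, u \in us -> (size u <= l)%N /\ u \notin L) ->
    (forall u, u \in L -> size u = l) ->
    (forall u, u \in L2 -> size u = l.+1 /\ behead u \notin L) ->
    (\int[P]_(w in cylinder us rho) (history_weight f n.+1 h (xi^~ w) L *
       history_weight (fun m => f m.+1) n h (xi^~ w) L2)%:E =
     (\prod_(u <- us) p (rho u) * (weight (history_mean f n.+1 h) L *
        weight (history_mean (fun m => f m.+1) n h) L2))%:E)%E.
Proof.
move=> IHn f h us rho l L L2 f1 h1; pose f' m := f m.+1.
have f'1 m : unit_vector (f' m) by exact: f1.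
elim: L us rho L2 => [|v L IH] us rho L2 uus uL uL2 sus sL sL2.
  under eq_integral do rewrite history_weight_nil mul1r.
  rewrite (IHn f' h us rho l.+1 L2) //; first by rewrite {2}/weight big_nil mul1r.
    by move=> u /sus[].
  by move=> u /sL2[].
case/andP: uL => vL uL; have sv : size v = l by apply: sL; rewrite mem_head.
have vus : v \notin us.
  by apply/negP => /sus[_]; rewrite mem_head.
set g' := history_mean f' n h; set g := history_mean f n.+1 h.
have g'1 : unit_vector g' by exact: history_mean_unit.
have g1 : unit_vector g by exact: history_mean_unit.
(* [c] is the claimed value without the factor [G p g' (itype v)], which is the mean of
   [monomial g'] over the progeny of [v]. *)
pose c := \prod_(u <- us) p (rho u) * f 0%N (itype v) * weight g L * weight g' L2.
have pus0 : 0 <= \prod_(u <- us) p (rho u) by apply: prodr_ge0 => u _; exact: p_ge0.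
have c0 : 0 <= c.
  case/andP: (f1 0%N (itype v)) => ? ?; case/andP: (weight_unit L g1) => ? ?.
  by case/andP: (weight_unit L2 g'1) => ? ?; rewrite /c !mulr_ge0.
rewrite (@eq_integral_discrete _ _ _ P _ (xi v) (cylinder us rho) setT _
  (fun w => (monomial g' (xi v w))%:E) c) //.
- rewrite -(@EFin_Rintegral_unit _ _ _ P (fun w => monomial g' (xi v w))).
  + rewrite -(G_integral xi_family)// -EFinM; congr EFin.
    by rewrite /weight big_cons -/(weight g L) -/(weight g' L2) /c /g/= -/g'; ring.
  + exact: (xi_comp_measurable xi_family (monomial g')).
  + by move=> w; exact: monomial_unit.
- exact: (xi_discrete xi_family).
- apply/measurable_EFinP; apply: measurable_funM; exact: measurable_history_weight.
- apply/measurable_EFinP; exact: (xi_comp_measurable xi_family (monomial g')).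
- by move=> w; rewrite EFinM mule_ge0 ?F_unit.
- by move=> w; rewrite lee_fin; case/andP: (monomial_unit (xi v w) g'1).
move=> t; rewrite setTI.
rewrite [RHS](_ : _ = (c * (monomial g' t * p t))%:E); last first.
  rewrite (eq_integral (fun=> (monomial g' t)%:E)); last first.
    by move=> w; rewrite inE /= => ->.
  rewrite integral_cst; last exact: (xi_discrete xi_family [set t]).
  rewrite [X in (_ * (_ * X))%E](_ : _ = (p t)%:E) -?EFinM//.
  exact: (progeny_family_law xi_family).
rewrite cylinder_cons//; set rho' := dfwith _ _ _.
(* Once [xi v = t] is revealed, [v] joins the cylinder and its children join [L2]. [behead u] is the
   parent of [u]; the condition on it keeps the enlarged [L2] free of duplicates. *)
pose ch := [seq c :: v | c <- children t].
rewrite (eq_integral (fun w => (f 0%N (itype v))%:E * (history_weight f n.+1 h (xi^~ w) L *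
  history_weight f' n h (xi^~ w) (ch ++ L2))%:E)%E); last first.
  move=> w; rewrite inE => Hw; rewrite -EFinM; congr EFin.
  rewrite history_weight_cat -/f' -(cat1s v L) history_weight_cat.
  rewrite history_weightS -/f' {1}/weight big_seq1 /offspring/= cats0.
  rewrite /brood (Hw v (mem_head _ _)) /rho' dfwithin -/ch.
  by ring.
rewrite ge0_integralZl//; last 3 first.
- apply/measurable_EFinP; apply: measurable_funTS.
  apply: measurable_funM; exact: measurable_history_weight.
- by move=> w _; rewrite EFinM mule_ge0 ?F_unit.
- by rewrite lee_fin; case/andP: (f1 0%N (itype v)).
have sch u : u \in ch -> size u = l.+1 /\ behead u = v.
  by move=> /mapP[c' _ ->] /=; rewrite sv.
rewrite (IH (v :: us) rho' (ch ++ L2)).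
- rewrite -EFinM weight_cat /ch weight_children big_cons -/f' -/g' -/g.
  rewrite /rho' dfwithin.
  rewrite [X in _ * (_ * X * _)](_ : _ = \prod_(u <- us) p (rho u)).
    by congr EFin; rewrite /c; ring.
  apply: eq_big_seq => u uus'; rewrite dfwithout//.
  by apply: contraNneq vus => ->.
- by rewrite /= vus.
- by [].
- rewrite cat_uniq uL2 andbT (map_inj_uniq (_ : injective (cons^~ v))) ?children_uniq/=.
    apply/hasPn => u uL2'; apply/negP => /sch[_ uv].
    by have [_] := sL2 u uL2'; rewrite uv mem_head.
  by move=> a b [].
- move=> u; rewrite inE => /predU1P[->|/sus[su]]; first by rewrite sv.
  by rewrite inE negb_or => /andP[].
- by move=> u uL'; apply: sL; rewrite inE uL' orbT.
- move=> u; rewrite mem_cat => /orP[/sch[-> ->]//|/sL2[-> ]].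
  by rewrite inE negb_or => /andP[].
Qed.

(** The length of a label tells the generation. Labels in [us] are shorter than those in [L], so
    nothing about [L] or its descendants has been revealed. *)
Let branching_cylinder n f h us rho l (L : seq indiv) :
  (forall m, unit_vector (f m)) -> unit_vector h ->
  uniq us -> uniq L -> (forall u, u \in us -> (size u < l)%N) ->
  (forall u, u \in L -> size u = l) ->
  (\int[P]_(w in cylinder us rho) (history_weight f n h (xi^~ w) L)%:E =
    (\prod_(u <- us) p (rho u) * weight (history_mean f n h) L)%:E)%E.
Proof.
elim: n f h us rho l L => [|n IH] f h us rho l L f1 h1 uus uL sus sL.
  under eq_integral do rewrite /history_weight big_ord0 mul1r /=.
  by rewrite integral_cst// [X in (_ * X)%E](P_cylinder rho uus) -EFinM mulrC.
have := @branching_step n IH f h us rho l L [::] f1 h1 uus uL isT.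
under eq_integral do rewrite history_weight_nil mulr1.
move=> ->//; first by rewrite {2}/weight big_nil mulr1.
move=> u uus'; split; first exact: ltnW (sus _ uus').
by apply/negP => /sL su; have := sus _ uus'; rewrite su ltnn.
Qed.

Lemma branching_formula n f h i : (forall m, unit_vector (f m)) -> unit_vector h ->
  \int[P]_w history_weight f n h (xi^~ w) [:: [:: (i, 0%N)]] = history_mean f n h i.
Proof.
move=> f1 h1.
(* An arbitrary value: the cylinder over the empty list is the whole space. *)
pose rho0 : forall u : indiv, progeny (itype u) := fun u => [ffun=> 0%N].
have := @branching_cylinder n f h [::] rho0 1 [:: [:: (i, 0%N)]] f1 h1 isT isT.
rewrite (_ : cylinder [::] _ = setT); last by apply/seteqP; split.
rewrite /Rintegral => ->//; first by rewrite /weight big_nil big_seq1 mul1r.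
by move=> u; rewrite inE => /eqP ->.
Qed.

(** The definition splits off the first generation, as the branching at the founder dictates.
    Splitting off the last one compares times [n] and [n + 1], as martingale arguments require. *)
Lemma history_meanSr n f h : history_mean f n.+1 h =
  history_mean f n (fun i => f n i * G p h i).
Proof.
elim: n f => [//|n IH] f; apply/funext => i.
exact: (congr1 (fun g => f 0%N i * G p g i) (IH (fun m => f m.+1))).
Qed.

End BranchingFormula.

(** The limit is the supremum of the levels that [x] reaches on a set of [U]. One ultrafilter serves
    all coordinates of a sequence of vectors, in place of a diagonal extraction. *)
Lemma ultra_cvg (R : realType) (T : Type) (U : set_system T) (x : T -> R) :
  UltraFilter U -> (forall m, 0 <= x m <= 1) -> exists2 l : R, 0 <= l <= 1 & x @ U --> l.
Proof.
move=> UU x1; pose A := [set y | U [set m | y <= x m]].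
have A0 : A 0 by apply: filterS filterT => m _; case/andP: (x1 m).
have A1 : ubound A 1.
  move=> y Ay; have [m /= ym] := @filter_ex _ U _ _ Ay.
  by apply: (le_trans ym); case/andP: (x1 m).
have supA : has_sup A by split; [exists 0|exists 1].
exists (sup A).
  by apply/andP; split; [apply: ub_le_sup => //; exists 1|apply: ge_sup => //; exists 0].
apply/cvgrPdist_le => e e0.
have [y Ay ye] := sup_adherent e0 supA.
have [Ae|Ae] := in_ultra_setVsetC [set m | sup A + e <= x m] UU.
  have := ub_le_sup supA.2 Ae; rewrite gerDl => e0'.
  by have := lt_le_trans e0 e0'; rewrite ltxx.
near=> m; rewrite ler_norml; apply/andP; split.
  suff : ~ (sup A + e <= x m) by move/negP; rewrite -ltNge => ?; lra.
  by near: m.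
suff : y <= x m by move=> ?; lra.
by near: m.
Unshelve. all: by end_near. Qed.

(** * Monotone iteration from a subsolution *)

Section MonotoneIteration.
Context (R : realType) (T : (nat -> R) -> nat -> R) (x0 : nat -> R).
Hypothesis T_unit : forall x, unit_vector x -> unit_vector (T x).
Hypothesis T_le : forall x y, unit_vector x -> unit_vector y ->
  (forall k, x k <= y k) -> forall k, T x k <= T y k.
Hypothesis T_cvg : forall (x : nat -> nat -> R) s, (forall n, unit_vector (x n)) ->
  unit_vector s -> (forall k, x ^~ k @ \oo --> s k) ->
  forall k, (fun n => T (x n) k) @ \oo --> T s k.
Hypothesis x0_unit : unit_vector x0.
Hypothesis x0_le : forall k, x0 k <= T x0 k.

Lemma iter_unit n : unit_vector (iter n T x0).
Proof. by elim: n => //= n; exact: T_unit. Qed.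

Lemma le_iterS n k : iter n T x0 k <= iter n.+1 T x0 k.
Proof.
elim: n k => [|n IH] k; first exact: x0_le.
exact: (T_le (iter_unit n) (iter_unit n.+1)).
Qed.

Lemma iter_homo k : {homo (fun n => iter n T x0 k) : n m / (n <= m)%N >-> n <= m}.
Proof. by apply: homo_leq => [x|y x z|n]; [exact: lexx|exact: le_trans|exact: le_iterS]. Qed.

Lemma iter_le_fixed z : unit_vector z -> T z = z -> (forall k, x0 k <= z k) ->
  forall n k, iter n T x0 k <= z k.
Proof.
move=> z1 zT x0z; elim=> [|n IH] k //.
by rewrite -zT; exact: (T_le (iter_unit n) z1).
Qed.

(** Applied to [G] and to its truncations. The last clause makes the limit the least upper bound of
    the iterates, so bounds on it can be proved iterate by iterate. *)
Lemma iter_limit : exists y, [/\ unit_vector y, T y = y,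
  forall k, (fun n => iter n T x0 k) @ \oo --> y k,
  forall n k, iter n T x0 k <= y k &
  forall z, (forall n k, iter n T x0 k <= z k) -> forall k, y k <= z k].
Proof.
pose y k := sup (range (fun n => iter n T x0 k)).
have ub k : has_ubound (range (fun n => iter n T x0 k)).
  by exists 1 => _ [n _ <-]; case/andP: (iter_unit n k).
have yc k : (fun n => iter n T x0 k) @ \oo --> y k.
  by apply: nondecreasing_cvgn => //; exact: iter_homo.
have ley n k : iter n T x0 k <= y k by apply: ub_le_sup => //; exists n.
have ymin z : (forall n k, iter n T x0 k <= z k) -> forall k, y k <= z k.
  by move=> H k; apply: ge_sup; [exists (x0 k); exists 0%N|move=> _ [n _ <-]].
have y1 : unit_vector y.
  move=> k; apply/andP; split.
    by apply: (le_trans _ (ley 0%N k)); case/andP: (x0_unit k).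
  by apply: (ymin (fun=> 1)) => n k'; case/andP: (iter_unit n k').
exists y; split => //; apply/funext => k.
have c1 : (fun n => iter n.+1 T x0 k) @ \oo --> T y k.
  by apply: T_cvg => //; exact: iter_unit.
have c2 : (fun n => iter n.+1 T x0 k) @ \oo --> y k.
  by have := yc k; rewrite -(cvg_shiftS (fun n => iter n T x0 k)).
exact: (cvg_unique _ c1 c2).
Qed.

End MonotoneIteration.

(** * Solutions of truncated systems *)

Section FixedPoints.
Context (R : realType) (p : forall i : nat, progeny i -> R).
Context (d : measure_display) (Omega : measurableType d) (P : probability Omega R).
Context (xi : forall u : indiv, Omega -> progeny (itype u)).
Context (xi_family : is_progeny_family P xi p).

Lemma unit_vector0 : unit_vector (fun=> 0 : R).
Proof. by move=> k; rewrite lexx ler01. Qed.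
Hint Resolve unit_vector0 : core.

Lemma fixed_points_one : fixed_points p (fun=> 1).
Proof. by split; [exact: unit_vector1|rewrite (G1 xi_family)]. Qed.

Lemma subsolution_limit x0 : unit_vector x0 -> (forall k, x0 k <= G p x0 k) ->
  exists y, [/\ fixed_points p y,
  forall k, (fun n => iter n (G p) x0 k) @ \oo --> y k &
  forall n k, iter n (G p) x0 k <= y k].
Proof.
move=> x01 x0G.
have [] := @iter_limit R (G p) x0 (G_unit xi_family) (le_G xi_family) _ x01 x0G.
  move=> x s x1 s1 xs k; apply: (cvg_G xi_family) => //.
  by apply: filterE.
by move=> y [y1 yG yc yn _]; exists y.
Qed.

(** By the lower Hessenberg form the first [m + 1] equations see only coordinate [m + 1] outside
    their block, so one number [u] closes the system. *)
Definition truncated (m : nat) (u : R) (s : nat -> R) (j : nat) : R :=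
  if (j <= m)%N then G p s j else u.

Section Truncated.
Variable m : nat.

Lemma truncated_unit u s : 0 <= u <= 1 -> unit_vector s -> unit_vector (truncated m u s).
Proof. by move=> u1 s1 k; rewrite /truncated; case: ifP => // _; exact: (G_unit xi_family). Qed.

Lemma le_truncated u v x y : u <= v -> unit_vector x -> unit_vector y ->
  (forall k, x k <= y k) -> forall k, truncated m u x k <= truncated m v y k.
Proof.
by move=> uv x1 y1 xy k; rewrite /truncated; case: ifP => // _; exact: (le_G xi_family).
Qed.

Let iter_truncated_unit u n : 0 <= u <= 1 -> unit_vector (iter n (truncated m u) (fun=> 0)).
Proof. by move=> u1; apply: iter_unit => // x; exact: truncated_unit. Qed.

(** The condition on [u] stands under the existential so that [psi] is a total function of [u]. *)
Lemma truncated_limit u : exists y, 0 <= u <= 1 ->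
  [/\ unit_vector y, truncated m u y = y,
  forall n k, iter n (truncated m u) (fun=> 0) k <= y k &
  forall z, (forall n k, iter n (truncated m u) (fun=> 0) k <= z k) -> forall k, y k <= z k].
Proof.
have [u1|u1] := boolP (0 <= u <= 1); last by exists (fun=> 0).
have [] := @iter_limit R (truncated m u) (fun=> 0) _ _ _ unit_vector0 _.
- by move=> x; exact: truncated_unit.
- by move=> x y; exact: le_truncated.
- move=> x s x1 s1 xs k; rewrite /truncated; case: ifP => _; last exact: cvg_cst.
  by apply: (cvg_G xi_family) => //; exact: filterE.
- by move=> k; case/andP: (truncated_unit u1 unit_vector0 k).
by move=> y [y1 yT _ yn ymin]; exists y.
Qed.

(** Probabilistically, [psi m u j] is the mean of [u ^ N] on the event that the types up to [m] die
    out, where individuals of type [> m] are frozen and [N] counts them. *)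
Definition psi u := sval (cid (truncated_limit u)).

Lemma psiP u : 0 <= u <= 1 -> [/\ unit_vector (psi u), truncated m u (psi u) = psi u,
  forall n k, iter n (truncated m u) (fun=> 0) k <= psi u k &
  forall z, (forall n k, iter n (truncated m u) (fun=> 0) k <= z k) ->
    forall k, psi u k <= z k].
Proof. by rewrite /psi; case: cid. Qed.

Lemma psi_min u z : 0 <= u <= 1 -> unit_vector z ->
  (forall k, truncated m u z k <= z k) -> forall k, psi u k <= z k.
Proof.
move=> u1 z1 zT; have [_ _ _ H] := psiP u1; apply: H.
elim=> [|n IH] k /=; first by case/andP: (z1 k).
apply: (le_trans _ (zT k)); apply: le_truncated => //.
exact: iter_truncated_unit.
Qed.

Lemma le_psi u v : 0 <= u -> u <= v -> v <= 1 -> forall k, psi u k <= psi v k.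
Proof.
move=> u0 uv v1; have u01 : 0 <= u <= 1 by rewrite u0 (le_trans uv).
have v01 : 0 <= v <= 1 by rewrite v1 (le_trans u0).
have [Y1 YT _ _] := psiP v01; apply: psi_min => // k.
by rewrite -[leRHS](congr1 (@^~ k) YT); exact: le_truncated.
Qed.

(** Convexity passes through the iterates: those for [u] lie below those for [v], which is the
    ordering that [G_convex] asks for. *)
Lemma psi_convex u v t k : 0 <= u -> u <= v -> v <= 1 -> 0 <= t <= 1 ->
  psi ((1 - t) * u + t * v) k <= (1 - t) * psi u k + t * psi v k.
Proof.
move=> u0 uv v1 t01; have u01 : 0 <= u <= 1 by rewrite u0 (le_trans uv).
have v01 : 0 <= v <= 1 by rewrite v1 (le_trans u0).
have /andP[t0 t1] := t01.
have w01 : 0 <= (1 - t) * u + t * v <= 1 by nra.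
have [_ _ _ H] := psiP w01.
apply: (H (fun k => (1 - t) * psi u k + t * psi v k)) => {H} n {}k.
have [_ _ Hu _] := psiP u01; have [_ _ Hv _] := psiP v01.
suff H : iter n (truncated m ((1 - t) * u + t * v)) (fun=> 0) k <=
    (1 - t) * iter n (truncated m u) (fun=> 0) k + t * iter n (truncated m v) (fun=> 0) k.
  by apply: (le_trans H); apply: lerD; apply: ler_wpM2l => //; lra.
elim: n k => [|n IH] k; first by rewrite !mulr0 addr0.
rewrite !iterS; set a := iter n (truncated m u) _ in IH *.
set b := iter n (truncated m v) _ in IH *; set c := iter n _ _ in IH *.
rewrite /truncated; case: ifP => // _.
have a1 : unit_vector a by exact: iter_truncated_unit.
have b1 : unit_vector b by exact: iter_truncated_unit.
have ab l : a l <= b l.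
  rewrite /a /b; elim: n {IH c a b a1 b1} l => //= n IH l.
  by apply: le_truncated => //; exact: iter_truncated_unit.
apply: (le_trans _ (G_convex xi_family k t01 a1 b1 ab)).
apply: (le_G xi_family) => //; first exact: iter_truncated_unit.
move=> l; have /andP[? ?] := a1 l; have /andP[? ?] := b1 l.
by apply/andP; split; [rewrite addr_ge0// mulr_ge0//; lra|nra].
Qed.

Let cvg_iter_truncated (u : nat -> R) (v : R) n k : (forall j, 0 <= u j <= 1) -> 0 <= v <= 1 ->
  u @ \oo --> v ->
  (fun j => iter n (truncated m (u j)) (fun=> 0) k) @ \oo -->
    iter n (truncated m v) (fun=> 0) k.
Proof.
move=> u1 v1 uv; elim: n k => [|n IH] k; first exact: cvg_cst.
have [km|km] := boolP (k <= m)%N; last first.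
  rewrite (_ : (fun j => _) = u); last by apply/funext => j; rewrite iterS {1}/truncated ifN.
  by rewrite iterS {1}/truncated ifN.
rewrite (_ : (fun j => _) = fun j => G p (iter n (truncated m (u j)) (fun=> 0)) k); last first.
  by apply/funext => j; rewrite iterS {1}/truncated km.
rewrite [X in _ --> X](_ : _ = G p (iter n (truncated m v) (fun=> 0)) k); last first.
  by rewrite iterS {1}/truncated km.
apply: (cvg_G xi_family) => //.
- by apply: filterE => j; exact: iter_truncated_unit.
- exact: iter_truncated_unit.
Qed.

(** Let [v] be the supremum of the [u] with [psi u k <= x]. Lower semicontinuity (a supremum of
    continuous iterates) gives [psi v k <= x]; were it strict, convexity on [[v, 1]] would give a
    larger such [u]. *)
Lemma psi_surj k x : psi 0 k <= x -> x <= psi 1 k -> exists2 u, 0 <= u <= 1 & psi u k = x.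
Proof.
move=> x0 x1; pose A := [set u | 0 <= u <= 1 /\ psi u k <= x].
have A0 : A 0 by split => //; rewrite lexx ler01.
have A1 : ubound A 1 by move=> u [/andP[]].
have supA : has_sup A by split; [exists 0|exists 1].
pose v := sup A.
have v0 : 0 <= v by apply: ub_le_sup => //; exists 1.
have v1 : v <= 1 by apply: ge_sup => //; exists 0.
have v01 : 0 <= v <= 1 by rewrite v0.
have Av : psi v k <= x.
  have [v00|vN0] := eqVneq v 0; first by rewrite v00.
  have {vN0}v_gt0 : 0 < v by rewrite lt_neqAle eq_sym vN0.
  pose u j := v * (1 - harmonic j).
  have hp j : 0 < harmonic j :> R by rewrite /harmonic/=.
  have h1 j : harmonic j <= 1 :> R by rewrite /harmonic/= invf_le1// ler1n.
  have uv j : u j < v by rewrite /u gtr_pMr// ltrBlDr ltrDl.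
  have u0 j : 0 <= u j by rewrite /u mulr_ge0// subr_ge0.
  have u1 j : 0 <= u j <= 1 by rewrite u0 (le_trans (ltW (uv j))).
  have cu : u @ \oo --> v.
    rewrite -[X in _ --> X]mulr1; apply: cvgMr.
    rewrite -[X in _ --> X]subr0; apply: cvgB; first exact: cvg_cst.
    exact: cvg_harmonic.
  have Au j : psi (u j) k <= x.
    have vu : 0 < v - u j by rewrite subr_gt0.
    have [w [/andP[w0 w1] wx] uw] := sup_adherent vu supA.
    apply: (le_trans _ wx); apply: le_psi => //.
    by move: uw; rewrite -/v => ?; lra.
  have [_ _ _ H] := psiP v01.
  (* Only coordinate [k] is to be bounded; the others get the trivial bound. *)
  pose z l := if l == k then x else 1.
  suff /(_ k) : forall l, psi v l <= z l by rewrite /z eqxx.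
  apply: H => n l; rewrite /z; case: eqP => [->|_]; last first.
    by case/andP: (iter_truncated_unit n v01 l).
  apply: (@ler_cvg_to _ _ _ _ _ (fun=> x) _ _ (@cvg_iter_truncated _ _ n k u1 v01 cu) (cvg_cst x)).
  apply: filterE => j; have [_ _ Hn _] := psiP (u1 j).
  exact: (le_trans (Hn n k)).
exists v => //; apply/eqP; rewrite eq_le Av/= leNgt; apply/negP => vx.
have [v_eq1|vN1] := eqVneq v 1.
  by have := lt_le_trans vx x1; rewrite v_eq1 ltxx.
have {vN1}v_lt1 : v < 1 by rewrite lt_neqAle vN1.
set a := psi v k in vx; set b := psi 1 k in x1.
have ab : 0 < b - a by rewrite subr_gt0 (lt_le_trans vx).
(* The parameter at which the chord from [(v, a)] to [(1, b)] has height [x]. *)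
pose t := (x - a) / (b - a).
have t0 : 0 < t by rewrite divr_gt0// subr_gt0.
have t1 : t <= 1 by rewrite ler_pdivrMr// mul1r lerB.
have := @psi_convex v 1 t k v0 v1 (lexx 1); rewrite (ltW t0) t1 => /(_ isT).
rewrite -/a -/b (_ : (1 - t) * a + t * b = x); last first.
  rewrite (_ : (1 - t) * a + t * b = a + t * (b - a)); last by ring.
  by rewrite divfK ?gt_eqF// addrC subrK.
move=> wx; have Aw : A ((1 - t) * v + t * 1) by split => //; nra.
have := ub_le_sup supA.2 Aw; rewrite -/v => H.
have : 0 < t * (1 - v) by rewrite mulr_gt0// subr_gt0.
by nra.
Qed.

End Truncated.

(* Each s^(m) solves the first m + 1 equations and takes the value x at i; a
   limit along an ultrafilter solves all of them. *)
Lemma fixed_point_through i x : (forall m, psi m 0 i <= x) -> (forall m, x <= psi m 1 i) ->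
  exists s, fixed_points p s /\ s i = x.
Proof.
move=> x0 x1.
have /choice[u uP] m : exists u, 0 <= u <= 1 /\ psi m u i = x.
  by have [u ? ?] := @psi_surj m i x (x0 m) (x1 m); exists u.
pose s m := psi m (u m).
have s1 m : unit_vector (s m) by have [] := psiP m (uP m).1.
have sG m j : (j <= m)%N -> s m j = G p (s m) j.
  move=> jm; have [_ E _ _] := psiP m (uP m).1.
  by have := congr1 (@^~ j) E; rewrite /truncated jm => /esym.
have [U [UU oU]] := @ultraFilterLemma nat \oo _.
have /choice[l lP] j : exists l : R, 0 <= l <= 1 /\ s ^~ j @ U --> l.
  by have [l ? ?] := @ultra_cvg R nat U (s ^~ j) UU (fun m => s1 m j); exists l.
have l1 : unit_vector l by move=> j; exact: (lP j).1.
exists l; split; last first.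
  apply: (@cvg_unique _ (@Rhausdorff R) (s ^~ i @ U)); first exact: (lP i).2.
  rewrite (_ : s ^~ i = fun=> x); first exact: cvg_cst.
  by apply/funext => m; exact: (uP m).2.
split=> //; apply/funext => j.
apply: (@cvg_unique _ (@Rhausdorff R) (s ^~ j @ U)); first exact: (lP j).2.
(* Equation [j] holds only from [m = j] on; these [m] form a set of [U], which refines the filter at
   infinity. *)
have Uj : U [set m | (j <= m)%N] by apply: oU; exists j.
have GU := @cvg_G _ _ _ _ _ _ xi_family nat U _ s l j (@filterE _ U _ _ s1) l1
   (fun k _ => (lP k).2).
apply: cvg_trans (GU _ _); apply: near_eq_cvg; apply: filterS Uj => m /= jm.
by rewrite -sG.
Qed.

End FixedPoints.

(** * Extinction probabilities *)

Lemma cvg_nat_to0 (R : realType) (u : nat -> nat) :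
  ((u n)%:R : R) @[n --> \oo] --> (0 : R) <-> \forall n \near \oo, u n = 0%N.
Proof.
split => [u0|u0].
  have /cvgrPdist_lt/(_ 1 ltr01) : (fun n => (u n)%:R : R) @ \oo --> (0 : R) by [].
  apply: filterS => n; rewrite sub0r normrN ger0_norm// -[ltRHS]/(1%:R) ltr_nat.
  by rewrite ltnS leqn0 => /eqP.
by apply: cvg_near_cst; apply: filterS u0 => n ->.
Qed.

Lemma generation_nil x i n m : (n <= m)%N ->
  generation x i n = [::] -> generation x i m = [::].
Proof.
move=> nm gn; rewrite -(subnK nm); elim: (m - n)%N => [//|k].
by rewrite addSn /= => ->.
Qed.

Lemma total_population_ge1 (R : realType) x i n : generation x i n != [::] ->
  (1 <= \sum_(0 <= l <oo) ((pop x i n l)%:R : R)%:E)%E.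
Proof.
rewrite /pop; case: (generation x i n) => // u L _.
have := @nneseries_lim_ge R (fun l => ((count (fun u => itype u == l) (u :: L))%:R)%:E)
  xpredT 0 (itype u).+1.
move=> H; apply: (le_trans _ (H _)) => [|l _ _]; last by rewrite lee_fin.
rewrite big_nat_recr//=; apply: lee_paddl.
  by apply: sume_ge0 => l _; rewrite lee_fin.
by rewrite eqxx lee_fin add1n ler1n.
Qed.

Lemma total_population_cvg0 (R : realType) x i :
  (\sum_(0 <= l <oo) ((pop x i n l)%:R : R)%:E)%E @[n --> \oo] --> (0 : \bar R)%E <->
  exists n, generation x i n = [::].
Proof.
split => [|[n gn]].
  move=> /fine_cvgP[fin /cvgrPdist_lt/(_ 1 ltr01) lt1].
  have [n [/= fn ltn]] := @filter_ex _ _ _ _ (filterI fin lt1).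
  exists n; apply/eqP; apply: contraT => /(@total_population_ge1 R).
  rewrite -(fineK fn) lee_fin leNgt; move: ltn.
  by rewrite sub0r normrN => /(le_lt_trans (ler_norm _)) ->.
apply: cvg_near_cst; exists n => // m /= nm; apply: eseries0 => l _ _.
by rewrite /pop (generation_nil nm gn).
Qed.

Section Extinction.
Context (R : realType) (p : forall i : nat, progeny i -> R).
Context (p_law : is_progeny_law p).
Context (d : measure_display) (Omega : measurableType d) (P : probability Omega R).
Context (xi : forall u : indiv, Omega -> progeny (itype u)).
Context (xi_family : is_progeny_family P xi p).

Local Notation gen i n w := (generation (brood (xi^~ w)) i n).
Local Notation root i := [:: [:: (i, 0%N)]].

Lemma discrete_rv_generation i n : discrete_rv (fun w => gen i n w).
Proof.
rewrite (_ : (fun w => _) = fun w => iter n (offspring (xi^~ w)) (root i)).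
  exact: (discrete_rv_iter_offspring xi_family).
by apply/funext => w; rewrite generation_iter.
Qed.

(** Extinction and absence events have indicators of this form, so their probabilities satisfy
    recursions in [G]. *)
Lemma probability_history f n h i (A : set Omega) :
  (forall m, unit_vector (f m)) -> unit_vector h -> measurable A ->
  (forall w, history_weight f n h (xi^~ w) (root i) = \1_A w) ->
  fine (P A) = history_mean p f n h i.
Proof.
move=> f1 h1 mA AE; rewrite -(branching_formula p_law xi_family)//.
under eq_Rintegral do rewrite AE.
by rewrite /Rintegral integral_indic// setIT.
Qed.

Lemma cvg_fine_probability (F : (set Omega) ^nat) (A : set Omega) :
  measurable A -> P (F n) @[n --> \oo] --> P A ->
  fine (P (F n)) @[n --> \oo] --> fine (P A).
Proof.
move=> mA FA; apply: fine_cvg; rewrite fineK//.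
exact: fin_num_measure.
Qed.

Lemma cvg_probability_bigcup (F : (set Omega) ^nat) : (forall n, measurable (F n)) ->
  (forall n, F n `<=` F n.+1) ->
  fine (P (F n)) @[n --> \oo] --> fine (P (\bigcup_n F n)).
Proof.
move=> mF FS; apply: cvg_fine_probability; first exact: bigcup_measurable.
apply: nondecreasing_cvg_mu => //; first exact: bigcup_measurable.
by apply: homo_leq => [A|A B C|n]; [exact: lexx|exact: le_trans|apply/subsetPset].
Qed.

Lemma cvg_probability_bigcap (F : (set Omega) ^nat) : (forall n, measurable (F n)) ->
  (forall n, F n.+1 `<=` F n) ->
  fine (P (F n)) @[n --> \oo] --> fine (P (\bigcap_n F n)).
Proof.
move=> mF FS; apply: cvg_fine_probability; first exact: bigcap_measurable.
apply: nonincreasing_cvg_mu => //.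
- by rewrite (le_lt_trans (@probability_le1 _ _ _ P _ (mF _)))// ltry.
- exact: bigcap_measurable.
- apply: homo_leq => [A|A B C AB BC|n]; [exact: lexx|exact: le_trans BC AB|].
  exact/subsetPset.
Qed.

Lemma fine_probability_unit (A : set Omega) : measurable A -> 0 <= fine (P A) <= 1.
Proof.
move=> mA; have fA : P A \is a fin_num by exact: fin_num_measure.
by rewrite fine_ge0//= -lee_fin fineK// probability_le1.
Qed.

Lemma le_fine_probability (A B : set Omega) : measurable A -> measurable B ->
  A `<=` B -> fine (P A) <= fine (P B).
Proof.
by move=> mA mB AB; apply: fine_le; rewrite ?fin_num_measure// le_measure// inE.
Qed.

Lemma history_mean_one n h i : history_mean p (fun _ _ => 1) n h i = iter n (G p) h i.
Proof.
elim: n i => //= n IH i; rewrite mul1r; congr (G p _ i).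
by apply/funext => j; exact: IH.
Qed.

Lemma weight_one L : weight (fun=> 1 : R) L = 1.
Proof. by rewrite /weight big1. Qed.

Local Notation q := (global_ext P xi).
Local Notation qt := (partial_ext P xi).

Lemma cvg_global_ext i : (fun n => iter n (G p) (fun=> 0) i) @ \oo --> q i.
Proof.
pose F n := [set w | gen i n w = [::]].
have mF n : measurable (F n) by exact: (@discrete_rv_generation i n [set [::]]).
rewrite [X in _ --> X](_ : q i = fine (P (\bigcup_n F n))); last first.
  congr (fine (P _)); apply/seteqP; split => w /=.
    by move=> /total_population_cvg0[n gn]; exists n.
  by move=> [n _ gn]; apply/total_population_cvg0; exists n.
(* The weight with [h = 0] is the indicator of an empty generation. *)
have -> : (fun n => iter n (G p) (fun=> 0) i) = fun n => fine (P (F n)).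
  apply/funext => n; rewrite -history_mean_one; apply/esym.
  apply: probability_history => //; [by move=> m; exact: unit_vector1|exact: unit_vector0|].
  move=> w; rewrite /history_weight big1; last by move=> m _; rewrite weight_one.
  rewrite mul1r -generation_iter indicE; case: (boolP (w \in F n)).
    by rewrite inE => ->; rewrite /weight big_nil.
  move=> wF; have : gen i n w != [::] by apply: contra wF => /eqP gn; rewrite inE.
  by case: (gen i n w) => // u L _; rewrite /weight big_cons mul0r.
by apply: cvg_probability_bigcup => // n w /= gn; rewrite /F /= gn.
Qed.

Lemma global_ext_fixed : fixed_points p q.
Proof.
have [] := @subsolution_limit _ _ _ _ _ _ xi_family (fun=> 0).
- exact: unit_vector0.
- by move=> k; case/andP: (G_unit xi_family (unit_vector0 R) k).
move=> y [Sy yc _]; suff -> : q = y by [].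
by apply/funext => i; exact: (cvg_unique _ (@cvg_global_ext i) (yc i)).
Qed.

Lemma global_ext_min s : fixed_points p s -> forall i, q i <= s i.
Proof.
move=> [s1 sG] i; apply: (@ler_cvg_to _ _ _ _ _ (fun=> s i) _ _ (@cvg_global_ext i) (cvg_cst _)).
apply: filterE => n; apply: (iter_le_fixed (T := G p)) => //.
- exact: (G_unit xi_family).
- exact: (le_G xi_family).
- exact: unit_vector0.
- by move=> k; case/andP: (s1 k).
Qed.

(** * Absence of the types up to [L] from late generations *)

Definition above (L l : nat) : R := (L < l)%:R.

Definition above_from (L m n : nat) : nat -> R := if (m <= n)%N then above L else fun=> 1.

Lemma above_unit L : unit_vector (above L).
Proof. by move=> k; rewrite /above; case: (_ < _)%N; rewrite ?ler01 ?lexx. Qed.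

Lemma above_from_unit L m n : unit_vector (above_from L m n).
Proof. by rewrite /above_from; case: ifP => _; [exact: above_unit|exact: unit_vector1]. Qed.

Lemma weight_above L l : weight (above L) l = (all (fun u => L < itype u)%N l)%:R.
Proof.
rewrite /weight; elim: l => [|u l IH] /=; first by rewrite big_nil.
by rewrite big_cons IH /above -natrM mulnb.
Qed.

Definition absent (L m N i : nat) := [set w | forall n, (m <= n <= N)%N ->
  all (fun u => L < itype u)%N (gen i n w)].

Lemma measurable_absent L m N i : measurable (absent L m N i).
Proof.
rewrite (_ : absent _ _ _ _ = \bigcap_(n in [set n | (m <= n <= N)%N])
  [set w | all (fun u => L < itype u)%N (gen i n w)]); last first.
  by apply/seteqP; split.
apply: bigcap_measurableType => n _.
exact: (@discrete_rv_generation i n [set l | all (fun u => L < itype u)%N l]).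
Qed.

(** With the horizon written [m + N], raising [m] only prepends a generation of weight 1, that is,
    applies [G] once. *)
Definition absent_mean L m N : nat -> R :=
  history_mean p (above_from L m) (m + N) (above_from L m (m + N)).

Lemma fine_probability_absent L m N i : fine (P (absent L m (m + N) i)) = absent_mean L m N i.
Proof.
apply: probability_history.
- exact: above_from_unit.
- exact: above_from_unit.
- exact: measurable_absent.
move=> w; transitivity (\prod_(n < (m + N).+1)
    weight (above_from L m n) (iter n (offspring (xi^~ w)) (root i))).
  by rewrite big_ord_recr.
have wE n : weight (above_from L m n) (iter n (offspring (xi^~ w)) (root i)) =
    ((m <= n)%N ==> all (fun u => L < itype u)%N (gen i n w))%:R.
  rewrite /above_from -generation_iter; case: (leqP m n) => _ /=; last exact: weight_one.
  exact: weight_above.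
rewrite indicE; case: (boolP (w \in absent L m (m + N) i)) => [|wA].
  rewrite inE => wA; rewrite big1// => n _; rewrite wE; case: (leqP m n) => //= mn.
  by rewrite wA// mn/= -ltnS ltn_ord.
have [n mn nall] : exists2 n, (m <= n <= m + N)%N &
    ~~ all (fun u => L < itype u)%N (gen i n w).
  apply: contrapT => H; move/negP: wA; apply; rewrite inE => n mn.
  by apply: contraT => nall; exfalso; apply: H; exists n.
case/andP: mn => mn nN.
rewrite (bigD1 (Ordinal (nN : (n < (m + N).+1)%N)))//= wE mn/=.
by rewrite (negbTE nall) mul0r.
Qed.

Lemma absent_mean_unit L m N : unit_vector (absent_mean L m N).
Proof.
by apply: (history_mean_unit xi_family); [exact: above_from_unit|exact: above_from_unit].
Qed.

Lemma absent_meanS L m N : absent_mean L m.+1 N = G p (absent_mean L m N).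
Proof. by apply/funext => i; rewrite /absent_mean addSn /= mul1r. Qed.

(** The events decrease in [N], then increase in [m], then decrease in [L]. Continuity of [G]
    carries the recursion through the three limits, the last of which is [qt]. *)
Definition absent_from L m i := fine (P (\bigcap_N absent L m (m + N) i)).
Definition absent_eventually L i := fine (P (\bigcup_m \bigcap_N absent L m (m + N) i)).

Lemma measurable_absent_from L m i : measurable (\bigcap_N absent L m (m + N) i).
Proof. by apply: bigcap_measurableType => N _; exact: measurable_absent. Qed.

Lemma measurable_absent_eventually L i : measurable (\bigcup_m \bigcap_N absent L m (m + N) i).
Proof. by apply: bigcup_measurable => m _; exact: measurable_absent_from. Qed.

Lemma cvg_absent_mean L m i : absent_mean L m N i @[N --> \oo] --> absent_from L m i.
Proof.
rewrite (_ : (fun N => _) = fun N => fine (P (absent L m (m + N) i))); last first.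
  by apply/funext => N; rewrite fine_probability_absent.
apply: (@cvg_probability_bigcap (fun N => absent L m (m + N) i)).
  by move=> N; exact: measurable_absent.
move=> N w /= H n /andP[mn nN]; apply: H.
by rewrite mn/= (leq_trans nN)// leq_add2l.
Qed.

Lemma absent_from_unit L m : unit_vector (absent_from L m).
Proof. by move=> i; apply: fine_probability_unit; exact: measurable_absent_from. Qed.

Lemma absent_eventually_unit L : unit_vector (absent_eventually L).
Proof. by move=> i; apply: fine_probability_unit; exact: measurable_absent_eventually. Qed.

Lemma absent_fromS L m : absent_from L m.+1 = G p (absent_from L m).
Proof.
apply/funext => i.
apply: (@cvg_unique _ (@Rhausdorff R) (absent_mean L m.+1 N i @[N --> \oo])).
  exact: cvg_absent_mean.
rewrite /=; under eq_fun do rewrite absent_meanS.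
apply: (cvg_G xi_family).
- by apply: filterE => N; exact: absent_mean_unit.
- exact: absent_from_unit.
- by move=> k _; exact: cvg_absent_mean.
Qed.

Lemma cvg_absent_from L i : absent_from L m i @[m --> \oo] --> absent_eventually L i.
Proof.
apply: (@cvg_probability_bigcup (fun m => \bigcap_N absent L m (m + N) i)).
  by move=> m; exact: measurable_absent_from.
move=> m w H N _ n /andP[mn nN]; apply: (H N.+1) => //.
by rewrite addnS -addSn nN andbT ltnW.
Qed.

Lemma absent_eventually_fixed L : G p (absent_eventually L) = absent_eventually L.
Proof.
apply/funext => i; apply: (@cvg_unique _ (@Rhausdorff R) (absent_from L m.+1 i @[m --> \oo])).
  rewrite /=; under eq_fun do rewrite absent_fromS.
  apply: (cvg_G xi_family).
  - by apply: filterE => N; exact: absent_from_unit.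
  - exact: absent_eventually_unit.
  - by move=> k _; exact: cvg_absent_from.
by have := @cvg_absent_from L i; rewrite -(cvg_shiftS (fun m => absent_from L m i)).
Qed.

Lemma partial_ext_bigcap i :
  qt i = fine (P (\bigcap_L \bigcup_m \bigcap_N absent L m (m + N) i)).
Proof.
congr (fine (P _)); apply/seteqP; split => w /= H.
  move=> L _.
  have : \forall n \near \oo, forall l : 'I_L.+1, Z xi i n l w = 0%N.
    by apply: filter_forall => l; apply/(cvg_nat_to0 R); exact: H.
  case=> m _ mH; exists m => // N _ n /andP[mn _].
  apply/allP => u un; rewrite ltnNge; apply/negP => uL.
  have := mH n mn (Ordinal (uL : (itype u < L.+1)%N)); rewrite /Z /pop /= => /eqP.
  by rewrite -leqn0 leqNgt -has_count => /hasP; apply; exists u.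
move=> l; apply/(cvg_nat_to0 R); have [m _ mH] := H l I.
exists m => // n /= mn; rewrite /Z /pop; apply/eqP; rewrite -leqn0 leqNgt -has_count.
apply/hasP => -[u un /eqP ul].
have := mH (n - m)%N I n; rewrite subnKC// mn leqnn => /(_ isT)/allP/(_ u un).
by rewrite ul ltnn.
Qed.

Lemma cvg_absent_eventually i : absent_eventually L i @[L --> \oo] --> qt i.
Proof.
rewrite partial_ext_bigcap.
apply: (@cvg_probability_bigcap (fun L => \bigcup_m \bigcap_N absent L m (m + N) i)).
  by move=> L; exact: measurable_absent_eventually.
move=> L w [m _ H]; exists m => // N _ n mn; apply: sub_all (H N I n mn) => u.
exact: ltnW.
Qed.

Lemma partial_ext_unit : unit_vector qt.
Proof.
move=> i; rewrite partial_ext_bigcap; apply: fine_probability_unit.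
by apply: bigcap_measurableType => L _; exact: measurable_absent_eventually.
Qed.

Lemma partial_ext_fixed : fixed_points p qt.
Proof.
split; first exact: partial_ext_unit.
apply/funext => i.
apply: (@cvg_unique _ (@Rhausdorff R) (absent_eventually L i @[L --> \oo])).
  exact: cvg_absent_eventually.
rewrite (_ : (fun L => absent_eventually L i) = fun L => G p (absent_eventually L) i); last first.
  by apply/funext => L; rewrite absent_eventually_fixed.
apply: (cvg_G xi_family).
- by apply: filterE => L; exact: absent_eventually_unit.
- exact: partial_ext_unit.
- by move=> k _; exact: cvg_absent_eventually.
Qed.

Lemma le_partial_ext s i : (forall L, s <= absent_eventually L i) -> s <= qt i.
Proof.
move=> H; apply: (@ler_cvg_to _ _ _ _ (fun=> s) _ _ _ (cvg_cst s) (@cvg_absent_eventually i)).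
exact: filterE.
Qed.

(** Absence of the types up to [k] from the single generation [m] already has probability at most
    [psi k 1]. In the induction on [m], types up to [k] use one step of [G], and beyond [k] the
    bound is 1. *)
Lemma partial_ext_le_psi k i : qt i <= psi xi_family k 1 i.
Proof.
have one01 := unit_vector1 R 0%N.
have [psi1 psiT _ _] := psiP xi_family k one01.
have H m : forall j, absent_mean k m 0 j <= psi xi_family k 1 j.
  elim: m => [|m IH] j; rewrite -[leRHS](congr1 (@^~ j) psiT) /truncated.
    rewrite /absent_mean /= /above_from /= /above ltnNge.
    case: ifP => // _; by case/andP: (G_unit xi_family psi1 j).
  rewrite absent_meanS; case: ifP => _; last first.
    by case/andP: (G_unit xi_family (absent_mean_unit k m 0) j).
  by apply: (le_G xi_family) => //; exact: absent_mean_unit.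
apply: (@le_trans _ _ (absent_eventually k i)).
  rewrite partial_ext_bigcap; apply: le_fine_probability.
  - by apply: bigcap_measurableType => L _; exact: measurable_absent_eventually.
  - exact: measurable_absent_eventually.
  - by move=> w /(_ k I).
apply: (@ler_cvg_to _ _ _ _ _ (fun=> psi xi_family k 1 i) _ _ (@cvg_absent_from k i) (cvg_cst _)).
apply: filterE => m; apply: (le_trans _ (H m i)).
rewrite -fine_probability_absent; apply: le_fine_probability.
- exact: measurable_absent_from.
- exact: measurable_absent.
- by move=> w /(_ 0%N I).
Qed.

End Extinction.

(** * Maximality of the partial extinction probability *)

Lemma unit_vector_sqr (R : realType) (s : nat -> R) :
  unit_vector s -> unit_vector (fun k => s k ^+ 2).
Proof. by move=> s1 k; case/andP: (s1 k) => ? ?; rewrite exprn_ge0//= exprn_ile1. Qed.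

Section MaximalFixedPoint.
Context (R : realType) (p : forall i : nat, progeny i -> R).
Context (p_law : is_progeny_law p).
Context (d : measure_display) (Omega : measurableType d) (P : probability Omega R).
Context (xi : forall u : indiv, Omega -> progeny (itype u)).
Context (xi_family : is_progeny_family P xi p).
Context (irr : irreducible_type_graph p) (nsing : nonsingular p).

Local Notation root i := [:: [:: (i, 0%N)]].

(** For [0 < c < 1], the equation [c ^ n = c] forces [n = 1]: every individual would have exactly
    one child, against non-singularity. *)
Lemma fixed_point_not_cst (c : R) : 0 < c -> c < 1 -> ~ (forall i (r : progeny i), 0 < p r ->
  monomial (fun=> c) r = c :> R).
Proof.
move=> c0 c1 H; have [i] := nsing; apply/negP; rewrite -leNgt.
rewrite -(p_law.2 i) [X in (_ <= X)%E]esum_mkcond; apply: le_esum => r _.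
case: ifPn => //; rewrite notin_setE /= => r1.
have := p_ge0 p_law r; rewrite le_eqVlt => /predU1P[<-//|pr].
have := H i r pr; rewrite monomial_cst.
case: (progeny_size r) r1 => [_|[//|n] _].
  by rewrite expr0 => c1'; move: c1; rewrite -c1' ltxx.
move=> E; have : c ^+ n.+2 < c; last by rewrite E ltxx.
by rewrite exprS gtr_pMr// exprn_ilt1// ltW.
Qed.

(* Equality would make the martingale [prod s] deterministic; then s does not
   decrease along the edges of the type graph, so it is constant, and every
   individual has exactly one child. *)
Lemma variance_gap s y : fixed_points p s -> s <> (fun=> 1) -> fixed_points p y ->
  (forall k, s k ^+ 2 <= y k) -> forall l, s l = 0 \/ s l ^+ 2 < y l.
Proof.
move=> Ss sN1 Sy sy l; have [s1 sG] := Ss; have [y1 yG] := Sy.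
have [->|sl] := eqVneq (s l) 0; [by left|right; rewrite ltNge; apply/negP => yl].
have s21 := unit_vector_sqr s1.
pose Q j := 0 < s j /\ y j <= s j ^+ 2.
have step j (r : progeny j) : 0 < p r -> Q j -> monomial s r = s j /\
    forall k : 'I_j.+2, (0 < r k)%N -> Q k.
  move=> pr [sj yj].
  (* Under [Q j] the chain [s_j^2 = (G s)_j^2 <= G(s^2)_j <= (G y)_j = y_j <= s_j^2] collapses.
     Equality in Jensen fixes the monomials of [s]; the other equality gives [y = s^2] at the
     children. *)
  have Gsy : G p (fun k => s k ^+ 2) j <= y j.
    by rewrite yG; apply: (le_G xi_family).
  have sr : monomial s r = s j.
    rewrite (G_jensen_eq xi_family s1 _ pr) -?sG//.
    exact: le_trans Gsy yj.
  have s2r : monomial (fun k => s k ^+ 2) r = s j ^+ 2.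
    by rewrite -sr; exact: (monomialM s s r).
  split => // k rk; split.
    by apply: (lt_le_trans sj); rewrite -sr; exact: monomial_le_coord.
  rewrite -(@monomial_eq_coord _ _ (fun k => s k ^+ 2) y r _ _ _ k rk)//.
  - by move=> m; rewrite sqr_ge0 sy.
  - by rewrite s2r exprn_gt0.
  - apply: (eq_monomial_of_G xi_family) => //.
    rewrite -yG (le_trans yj)// {1}sG; exact: (G_jensen xi_family).
have Qall : forall j, Q j.
  apply: (@irreducible_ind _ _ p_law irr Q _ l); last first.
    by split => //; rewrite lt_neqAle eq_sym sl; case/andP: (s1 l).
  by move=> j r k pr rk Qj; have [_] := step j r pr Qj; exact.
have s_le j k : s j <= s k.
  apply: (@irreducible_ind _ _ p_law irr (fun k => s j <= s k) _ j) => //.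
  move=> i r m pr rm /le_trans; apply; rewrite -(step i r pr (Qall i)).1.
  exact: monomial_le_coord.
have sE : s = fun=> s l.
  by apply/funext => j; apply/eqP; rewrite eq_le !s_le.
apply: (@fixed_point_not_cst (s l)); first exact: (Qall l).1.
  exact: (fixed_point_lt1 p_law xi_family irr Ss sN1).
by move=> i r pr; rewrite -sE (step i r pr (Qall i)).1 sE.
Qed.

(** A minimum over finitely many ratios [y_l / s_l^2 - 1]; where [s_l = 0], any [k] will do. *)
Lemma uniform_gap (s y : nat -> R) L : (forall l, 0 <= y l) ->
  (forall l, s l = 0 \/ s l ^+ 2 < y l) ->
  exists2 k : R, 0 < k & forall l, (l <= L)%N -> (1 + k) * s l ^+ 2 <= y l.
Proof.
move=> y0 H; have gap l : exists2 k : R, 0 < k & (1 + k) * s l ^+ 2 <= y l.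
  have [->|sl] := eqVneq (s l) 0; first by exists 1 => //; rewrite expr0n/= mulr0.
  have [sl0|sy] := H l; first by rewrite sl0 eqxx in sl.
  have s2 : 0 < s l ^+ 2 by rewrite lt_neqAle sqr_ge0 andbT eq_sym sqrf_eq0.
  exists (y l / s l ^+ 2 - 1); first by rewrite subr_gt0 ltr_pdivlMr// mul1r.
  by rewrite addrC subrK divfK// gt_eqF.
elim: L => [|L [k k0 kL]].
  by have [k k0 ky] := gap 0%N; exists k => // l; rewrite leqn0 => /eqP->.
have [k' k'0 ky] := gap L.+1.
exists (Num.min k k'); first by rewrite lt_min k0.
move=> l; rewrite leq_eqVlt.
case/predU1P => [->|]; [apply: le_trans ky|rewrite ltnS => /kL; apply: le_trans];
  by rewrite ler_wpM2r ?sqr_ge0// lerD2l ge_min lexx ?orbT.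
Qed.

(** [history_mean] is not linear in [h], so linear combinations are compared at the level of the
    weights of a whole generation. The four slots are meant for [s], [y], [s^2] and 1. *)
Lemma history_mean_affine (f : nat -> nat -> R) n i
    (g1 g2 g3 g4 h1 h2 h3 h4 : nat -> R) (a b : R) :
  (forall m, unit_vector (f m)) ->
  unit_vector g1 -> unit_vector g2 -> unit_vector g3 -> unit_vector g4 ->
  unit_vector h1 -> unit_vector h2 -> unit_vector h3 -> unit_vector h4 ->
  (forall L, weight g1 L - a * (weight g2 L - weight g3 L) - b * weight g4 L <=
             weight h1 L - a * (weight h2 L - weight h3 L) - b * weight h4 L) ->
  let M h := history_mean p f n h i in
  M g1 - a * (M g2 - M g3) - b * M g4 <= M h1 - a * (M h2 - M h3) - b * M h4.
Proof.
move=> f1 ug1 ug2 ug3 ug4 uh1 uh2 uh3 uh4 H.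
pose M h := history_mean p f n h i.
change (M g1 - a * (M g2 - M g3) - b * M g4 <= M h1 - a * (M h2 - M h3) - b * M h4).
pose W h w := history_weight f n h (xi^~ w) (root i).
have WE h : unit_vector h -> M h = \int[P]_w W h w.
  by move=> h1'; rewrite (branching_formula p_law xi_family).
have iW h : unit_vector h -> P.-integrable setT (EFin \o W h).
  move=> h1'; apply: integrable_unit; first exact: (measurable_history_weight xi_family).
  by move=> w; exact: history_weight_unit.
have iWa k1 k2 k3 : unit_vector k1 -> unit_vector k2 -> unit_vector k3 ->
    P.-integrable setT (EFin \o (fun w => W k1 w - a * (W k2 w - W k3 w))).
  move=> ? ? ?; apply: integrable_EFinB; first exact: iW.
  by apply: integrable_EFinZ; apply: integrable_EFinB; exact: iW.
have iWb k1 k2 k3 k4 : unit_vector k1 -> unit_vector k2 -> unit_vector k3 -> unit_vector k4 ->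
    P.-integrable setT (EFin \o (fun w => W k1 w - a * (W k2 w - W k3 w) - b * W k4 w)).
  move=> ? ? ? ?; apply: integrable_EFinB; first exact: iWa.
  by apply: integrable_EFinZ; exact: iW.
have E k1 k2 k3 k4 : unit_vector k1 -> unit_vector k2 -> unit_vector k3 -> unit_vector k4 ->
    M k1 - a * (M k2 - M k3) - b * M k4 =
    \int[P]_w (W k1 w - a * (W k2 w - W k3 w) - b * W k4 w).
  move=> u1 u2 u3 u4; rewrite !WE// RintegralB//; last 2 first.
  - exact: iWa.
  - by apply: integrable_EFinZ; exact: iW.
  rewrite RintegralB//; last 2 first.
  - exact: iW.
  - by apply: integrable_EFinZ; apply: integrable_EFinB; exact: iW.
  rewrite !RintegralZl//; last 2 first.
  - exact: iW.
  - by apply: integrable_EFinB; exact: iW.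
  by rewrite RintegralB//; exact: iW.
rewrite !E//; apply: le_Rintegral => //; [exact: iWb|exact: iWb|].
move=> w _; rewrite /W /history_weight.
set A := \prod_(m < n) _.
have A0 : 0 <= A.
  apply: prodr_ge0 => m _.
  by case/andP: (weight_unit (iter m (offspring (xi^~ w)) (root i)) (f1 m)).
have E' x y z t : A * x - a * (A * y - A * z) - b * (A * t) = A * (x - a * (y - z) - b * t).
  by ring.
by rewrite !E' ler_wpM2l.
Qed.

Lemma weightM g h L : weight (fun k => g k * h k) L = weight g L * weight h L :> R.
Proof. by rewrite /weight -big_split. Qed.

Lemma le_weight (g h : nat -> R) L : (forall k, 0 <= g k <= h k) -> weight g L <= weight h L.
Proof. by move=> gh; apply: ler_prod => u _; exact: gh. Qed.

Lemma le_history_mean f n g h i : (forall m, unit_vector (f m)) ->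
  unit_vector g -> unit_vector h -> (forall k, g k <= h k) ->
  history_mean p f n g i <= history_mean p f n h i :> R.
Proof.
move=> f1 g1 h1 gh.
have := @history_mean_affine f n i g g g g h h h h 0 0 f1 g1 g1 g1 g1 h1 h1 h1 h1.
rewrite /= !mul0r !subr0; apply => L; rewrite !mul0r !subr0.
by apply: le_weight => k; rewrite gh andbT; case/andP: (g1 k).
Qed.

(* [M - C * (Y - M^2) - e] is a submartingale until the first visit after time m
   to a type <= L, and it is nonpositive at such a visit. *)
Lemma le_absent_mean s y L m N i (C e : R) :
  fixed_points p s -> fixed_points p y -> 0 <= C -> 0 <= e ->
  (forall k, s k ^+ 2 <= y k) ->
  (forall X, ~~ all (fun u => L < itype u)%N X ->
    weight s X - C * (weight y X - weight (fun k => s k ^+ 2) X) <= e) ->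
  s i - C * (y i - iter m (G p) (fun k => s k ^+ 2) i) - e <= absent_mean p L m N i.
Proof.
move=> [s1 sG] [y1 yG] C0 e0 sy He.
set s2 := fun k => s k ^+ 2.
have s21 : unit_vector s2 := unit_vector_sqr s1.
have f1 n : unit_vector (above_from R L m n) := @above_from_unit R L m n.
(* Contributions are killed by a type [<= L] in generations [m] to [n - 1]: [beta n] does not yet
   inspect generation [n], while [b n] does. Killing there only removes nonpositive
   contributions. *)
pose M n h := history_mean p (above_from R L m) n h i.
pose beta n := M n s - C * (M n y - M n s2) - e * M n (fun=> 1).
pose a h k := above R L k * h k.
have a1 h : unit_vector h -> unit_vector (a h).
  move=> h1 k; case/andP: (above_unit R L k) => ? ?; case/andP: (h1 k) => ? ?.
  by rewrite /a mulr_ge0//= mulr_ile1.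
have one1 := unit_vector1 R.
pose b n := M n (a s) - C * (M n (a y) - M n (a s2)) - e * M n (a (fun=> 1)).
have beta_b n : beta n <= b n.
  apply: history_mean_affine => //; try exact: a1.
  move=> X; rewrite !(weightM (above R L)) weight_one weight_above !mulr1.
  case: (boolP (all _ X)) => [_|/He HX]; first by rewrite !mul1r mulr1.
  by rewrite !mul0r subr0 !mulr0 !subr0 subr_le0.
have Mfix n h : G p h = h -> (m <= n)%N -> M n.+1 h = M n (a h).
  move=> hG mn; rewrite /M history_meanSr; congr (history_mean _ _ _ _ i).
  by apply/funext => k; rewrite /a /above_from mn hG.
(* One more generation preserves the means of [s], [y] and 1, which solve the equation, and by
   Jensen does not lower that of [s^2], which enters with the sign [+ C]. *)
have b_beta n : (m <= n)%N -> b n <= beta n.+1.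
  move=> mn; rewrite /b /beta (Mfix n s (esym sG) mn) (Mfix n y (esym yG) mn).
  rewrite (Mfix n (fun=> 1) (G1 xi_family) mn).
  rewrite lerD2r lerD2l lerN2; apply: ler_wpM2l => //; rewrite lerD2l lerN2.
  rewrite {2}/M history_meanSr; apply: le_history_mean => //; first exact: a1.
    move=> k; case/andP: (f1 n k) => ? ?; case/andP: (G_unit xi_family s21 k) => ? ?.
    by rewrite mulr_ge0//= mulr_ile1.
  move=> k; rewrite /a /above_from mn; apply: ler_wpM2l.
    by case/andP: (above_unit R L k).
  by rewrite /s2 {1}sG; exact: (G_jensen xi_family).
have beta_m : beta m = s i - C * (y i - iter m (G p) s2 i) - e.
  have Mm h : M m h = iter m (G p) h i.
    (* Splitting off first generations shifts [f]; the offset [m - k] records that the remaining [k]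
       generations still precede [m], where the weight is 1. *)
    rewrite /M; suff H k : (k <= m)%N ->
        history_mean p (fun n => above_from R L m (m - k + n)) k h = iter k (G p) h.
      by rewrite -(H m (leqnn m)) subnn; congr (history_mean _ _ _ _ i).
    elim: k => [//|k IH] km; apply/funext => j.
    rewrite /= {1}/above_from addn0 leqNgt ltn_subrL (leq_trans _ km)//= mul1r.
    rewrite -(IH (ltnW km)); congr (G p _ j); congr history_mean.
    by apply/funext => n; congr above_from; rewrite addnS -addSn subnSK.
  have Mfx h : G p h = h -> M m h = h i.
    by move=> hG; rewrite Mm; congr (_ i); elim: (m) => //= k ->.
  by rewrite /beta (Mfx s (esym sG)) (Mfx y (esym yG)) (Mfx _ (G1 xi_family)) Mm mulr1.
rewrite -/s2 -beta_m.
(* At the horizon the terms in [C] and [e] are dropped, being nonnegative and subtracted, and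
   [s <= 1] leaves the probability of absence. *)
apply: (@le_trans _ _ (b (m + N)%N)).
  apply: (le_trans (beta_b m)); elim: N => [|N IH]; first by rewrite addn0.
  rewrite addnS; apply: (le_trans IH); apply: (le_trans (b_beta _ _)); last exact: beta_b.
  exact: leq_addr.
have Ma1 : M (m + N)%N (a s) <= absent_mean p L m N i.
  apply: le_history_mean => //; first exact: a1.
  move=> k; rewrite /a /above_from leq_addr /=.
  case/andP: (s1 k) => s0 s1k; case/andP: (above_unit R L k) => a0 _.
  by rewrite -[leRHS]mulr1 ler_wpM2l.
have Ma2 : M (m + N)%N (a s2) <= M (m + N)%N (a y).
  apply: le_history_mean => //; try exact: a1.
  by move=> k; apply: ler_wpM2l; [case/andP: (above_unit R L k)|exact: sy].
have Ma3 : 0 <= M (m + N)%N (a (fun=> 1)).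
  by case/andP: (history_mean_unit xi_family (m + N) f1 (a1 _ one1) i).
rewrite -subr_ge0 in Ma2; have := mulr_ge0 C0 Ma2; have := mulr_ge0 e0 Ma3.
by rewrite /b; lra.
Qed.

(** With [L], [e] and hence [C] fixed, first [N] and then [m] tend to infinity; the second limit
    kills [C * (y_i - G^m(s^2)_i)]. The remaining error [e] is arbitrary. *)
Lemma fixed_point_le_partial_ext s : fixed_points p s -> s <> (fun=> 1) ->
  forall i, s i <= partial_ext P xi i.
Proof.
move=> Ss sN1 i; have [s1 sG] := Ss.
set s2 := fun k => s k ^+ 2.
have s21 : unit_vector s2 := unit_vector_sqr s1.
have s2G k : s2 k <= G p s2 k by rewrite /s2 {1}sG; exact: (G_jensen xi_family).
have [y [Sy yc ley]] := subsolution_limit xi_family s21 s2G.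
have sy k : s2 k <= y k := ley 0%N k.
have s20 k : 0 <= s2 k := sqr_ge0 (s k).
have [y1 yG] := Sy.
apply: (le_partial_ext xi_family) => L.
have y0 k : 0 <= y k by case/andP: (y1 k).
have [k k0 kL] := uniform_gap L y0 (variance_gap Ss sN1 Sy sy).
apply/ler_addgt0Pr => e e0.
(* At a visit to a type <= L, [M - C * (Y - M^2) <= M - M^2 / e <= e]. *)
pose C := (e * k)^-1.
have C0 : 0 < C by rewrite invr_gt0 mulr_gt0.
have weight_bound X : ~~ all (fun u => L < itype u)%N X ->
    weight s X - C * (weight y X - weight s2 X) <= e.
  move=> /allPn[u uX]; rewrite -leqNgt => uL.
  have s2X : weight s2 X = weight s X ^+ 2.
    by rewrite expr2 -weightM; congr weight; apply/funext => l; rewrite /s2 expr2.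
  have sX0 : 0 <= weight s X by case/andP: (weight_unit X s1).
  have yX : (1 + k) * weight s2 X <= weight y X.
    (* The one individual [u] of type [<= L] supplies the factor [1 + k]; the others need only
       [s^2 <= y]. *)
    rewrite /weight !(big_rem u uX)/= mulrA; apply: ler_pM.
    - by rewrite mulr_ge0// addr_ge0// ltW.
    - by apply: prodr_ge0 => v _; exact: s20.
    - exact: kL.
    - by apply: ler_prod => v _; rewrite s20/=; exact: sy.
  apply: (@le_trans _ _ (weight s X - e^-1 * weight s X ^+ 2)).
    rewrite lerD2l lerN2 -s2X (_ : e^-1 = C * k); last first.
      by rewrite /C invfM -mulrA mulVf ?mulr1// gt_eqF.
    by rewrite -mulrA ler_pM2l//; lra.
  set x := weight s X in sX0 *.
  have [xe|ex] := leP x e.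
    apply: (@le_trans _ _ x) => //; rewrite gerBl mulr_ge0 ?sqr_ge0//.
    by rewrite invr_ge0 ltW.
  apply: (@le_trans _ _ 0); last exact: ltW.
  by rewrite subr_le0 ler_pdivlMl// expr2 ler_pM2r// ?ltW// (lt_trans e0).
have bound m : s i - C * (y i - iter m (G p) s2 i) - e <= absent_from P xi L m i.
  apply: (@ler_cvg_to _ _ _ _ (fun=> s i - C * (y i - iter m (G p) s2 i) - e) _ _ _
    (cvg_cst _) (@cvg_absent_mean _ _ p_law _ _ _ _ xi_family L m i)).
  apply: filterE => N; apply: (@le_absent_mean s y) => //; exact: ltW.
rewrite -lerBlDr.
have cl : s i - C * (y i - iter m (G p) s2 i) - e @[m --> \oo] --> s i - e.
  rewrite [X in _ --> X](_ : _ = s i - C * (y i - y i) - e); last by rewrite subrr mulr0 subr0.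
  apply: cvgB; last exact: cvg_cst.
  apply: cvgB; first exact: cvg_cst.
  apply: cvgMr; apply: cvgB; first exact: cvg_cst.
  exact: yc.
apply: (@ler_cvg_to _ _ _ _ _ _ _ _ cl (@cvg_absent_from _ _ _ _ _ _ xi_family L i)).
exact: filterE.
Qed.

End MaximalFixedPoint.

(** * Solutions between the two extinction probabilities *)

Lemma fixed_point_between (R : realType) (p : forall i : nat, progeny i -> R)
    (p_law : is_progeny_law p)
    (d : measure_display) (Omega : measurableType d) (P : probability Omega R)
    (xi : forall u : indiv, Omega -> progeny (itype u))
    (xi_family : is_progeny_family P xi p) (i : nat) (x : R) :
  global_ext P xi i <= x -> x <= partial_ext P xi i ->
  exists s, fixed_points p s /\ s i = x.
Proof.
move=> qx xqt; apply: (fixed_point_through (xi_family := xi_family)) => m; last first.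
  exact: (le_trans xqt (partial_ext_le_psi p_law xi_family m i)).
apply: le_trans qx; have [q1 qG] := global_ext_fixed p_law xi_family.
apply: psi_min => //; first by rewrite lexx ler01.
move=> k; rewrite /truncated; case: ifP => _; first by rewrite -qG.
by case/andP: (q1 k).
Qed.

Theorem theorem1 (R : realType) (p : forall i : nat, progeny i -> R)
    (p_law : is_progeny_law p)
    (d : measure_display) (Omega : measurableType d) (P : probability Omega R)
    (xi : forall u : indiv, Omega -> progeny (itype u))
    (xi_family : is_progeny_family P xi p)
    (irr : irreducible_type_graph p)
    (nsing : nonsingular p)
    (M_pos : forall i : nat, (0 < mean_progeny p i i.+1)%E)
    (D : dichotomy P xi) :
  let one : nat -> R := fun=> 1 in
  let q : nat -> R := global_ext P xi in
  let qt : nat -> R := partial_ext P xi in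
  let S : set (nat -> R) := fixed_points p in
  [/\ S = [set one] -> q = one /\ qt = one,
      S <> [set one] ->
        (S q /\ forall s, S s -> forall i, q i <= s i) /\
        (forall i, qt i = sup [set s i | s in S `\ one]) &
      forall i, fixed_points_coord p i = `[q i, qt i] `|` [set 1]].
Proof.
move=> one q qt S.
have Sq : S q := global_ext_fixed p_law xi_family.
have Sqt : S qt := partial_ext_fixed p_law xi_family.
have S1 : S one := fixed_points_one xi_family.
have q_min : forall s, S s -> forall i, q i <= s i := global_ext_min p_law xi_family.
have qt_max : forall s, S s -> s <> one -> forall i, s i <= qt i :=
  fixed_point_le_partial_ext p_law xi_family irr nsing.
have S_between i x : q i <= x -> x <= qt i -> exists s, S s /\ s i = x :=
  @fixed_point_between _ _ p_law _ _ _ _ xi_family i x.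
split.
- by move=> SE; move: Sq Sqt; rewrite SE => /= -> ->.
- move=> SN1; split => // i.
  have [s0 [Ss0 s0N1]] : exists s, S s /\ s <> one.
    apply: contrapT => H; apply: SN1; apply/seteqP; split => [s Ss|s ->//].
    by apply: contrapT => sN1; apply: H; exists s.
  have ub : ubound [set s i | s in S `\ one] (qt i).
    by move=> _ [s [Ss sN1] <-]; exact: qt_max.
  have nonempty : [set s i | s in S `\ one] !=set0 by exists (s0 i), s0.
  have hsup : has_sup [set s i | s in S `\ one] by split => //; exists (qt i).
  apply/eqP; rewrite eq_le; apply/andP; split; last exact: ge_sup.
  (* If [qt <> 1], the supremum is attained at [qt]. Otherwise a supremum below [qt i] is refuted by
     an interpolating solution. *)
  have [qt1|qtN1] := pselect (qt = one); last first.
    by apply: ub_le_sup; [exists (qt i)|exists qt].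
  rewrite leNgt; apply/negP; set t := sup _ => ti.
  have qN1 : q <> one.
    move=> q1; apply: s0N1; apply/funext => j; apply/eqP; rewrite eq_le.
    by case/andP: (Ss0.1 j) => _ -> /=; rewrite -[leLHS]/(one j) -q1 q_min.
  have qt_i : q i <= t.
    apply: (le_trans (q_min s0 Ss0 i)); apply: ub_le_sup; first by exists (qt i).
    by exists s0.
  (* The solution through [x] exceeds the supremum at [i], yet differs from 1 because
     [x < qt i = 1]. *)
  pose x := (t + qt i) / 2.
  have tx : t < x by rewrite /x midf_lt.
  have xt : x < qt i by rewrite /x midf_lt.
  have [s [Ss si]] := S_between i x (le_trans qt_i (ltW tx)) (ltW xt).
  have : s i <= t.
    apply: ub_le_sup; first by exists (qt i).
    exists s => //; split => // s1.
    by move: xt; rewrite -si s1 qt1 ltxx.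
  by rewrite si leNgt tx.
- move=> i; apply/seteqP; split => [x [_ [s [Ss <-]]]|x].
    have [->|sN1] := pselect (s = one); first by right.
    by left; rewrite /= in_itv/= q_min// qt_max.
  case=> [|->]; last by split; [rewrite ler01 lexx|exists one].
  rewrite /= in_itv/= => /andP[qx xqt]; split; last exact: S_between.
  case/andP: (Sq.1 i) => q0 _; case/andP: (Sqt.1 i) => _ qt1.
  by rewrite (le_trans q0 qx) (le_trans xqt qt1).
Qed.
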